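(* We have $\frac{2}{t^2} \ge 3Q(t)^2$ whenever $0 < t \le 0.2$ or $t \ge 1.5$.
   Context: $Q(t)$, $t\ge 0$, denotes the radial profile of the positive radial ground state of $\Delta\phi - \phi + |\phi|^2\phi = 0$ on $\mathbb{R}^3$; it solves $-Q'' - \frac{2}{t}Q' + Q - Q^3 = 0$. *)

(* Defs.v *)
From Stdlib Require Import Reals.
From Coquelicot Require Import Coquelicot.
Open Scope R_scope.

(* Q is the radial profile (t >= 0) of a positive, radial, decaying,
   regular solution of  Delta phi - phi + phi^3 = 0  on R^3, i.e.
   - Q is twice differentiable on (0, oo) and satisfies
       -Q'' - (2/t) Q' + Q - Q^3 = 0   for t > 0;
   - Q is continuous at the origin from the right (regular, not singular);
   - Q(t) > 0 for all t >= 0;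
   - Q(t) -> 0 as t -> +oo.
   By the uniqueness theorem of Coffman (1972) / Kwong (1989) these
   conditions determine the ground state profile uniquely. *)
Definition ground_state_profile (Q : R -> R) : Prop :=
  exists Q1 Q2 : R -> R,
    (forall t : R, 0 < t -> is_derive Q t (Q1 t)) /\
    (forall t : R, 0 < t -> is_derive Q1 t (Q2 t)) /\
    (forall t : R, 0 < t -> - Q2 t - (2 / t) * Q1 t + Q t - (Q t) ^ 3 = 0) /\
    filterlim Q (at_right 0) (locally (Q 0)) /\
    (forall t : R, 0 <= t -> 0 < Q t) /\
    is_lim Q p_infty 0.

(* Main.v *)
Require Import Defs.
From Stdlib Require Import Reals Lra Psatz Classical.
From Coquelicot Require Import Coquelicot.
Open Scope R_scope.

(** Put [u = t Q], [x = - t Q' / Q] and [N = t^2 (Q^2 - 1) = u^2 - t^2]. The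
    equation becomes [u'' = u - u^3 / t^2], and also the system
    [t x' = x^2 - x + N], [t N' = 2 N - 2 x (N + t^2)], which starts at
    [x = N = 0] when [t = 0]. The claim is [3 u^2 <= 2].

    Decay at infinity gives two constraints valid for all [t > 0]: the reduced
    energy [u'^2 - u^2 + u^4 / (2 t^2)] decreases to [0], so it is nonnegative,
    and [u + u' >= u^3 / (t (2 + 4 t))], since otherwise [u] would become negative.

    Regularity at the origin gives barriers [N <= B (x, t)] or [N >= B (x, t)]:
    the difference satisfies [t D' = c D + r] with [c -> -1] as [t -> 0], so
    that [D >= 0] as soon as [r >= 0].

    For [t >= 3/2]: under [N <= 3 x - 9/5 x^2] the energy constraint fails at
    [t = 3/2] unless [x] reaches [5 t / 3] before [t = 3/4]; from then on
    [N >= 3 x - 2 x^2] makes [x] so large that [u] drops below [sqrt (2/3)] at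
    [3/2].

    For [t <= 1/5]: if [3 u^2 > 2] at such a time, then a quartic lower barrier for
    [N] forces [x > 2] at [t = 11/10], against the second constraint. *)

(** * Calculus on intervals: monotonicity, first zeros, linear differential inequalities *)

Lemma nondecreasing_of_derive_nonneg (f df : R -> R) (a b : R) :
  a <= b ->
  (forall t, a <= t <= b -> is_derive f t (df t)) ->
  (forall t, a <= t <= b -> 0 <= df t) ->
  f a <= f b.
Proof.
intros Hab Hd Hp.
destruct (MVT_gen f a b df) as [c [Hc Heq]].
- intros t Ht. rewrite Rmin_left, Rmax_right in Ht by lra. apply Hd; lra.
- intros t Ht. rewrite Rmin_left, Rmax_right in Ht by lra.
  apply continuity_pt_filterlim, (ex_derive_continuous (V := R_NormedModule)).
  exists (df t). apply Hd; lra.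
- rewrite Rmin_left, Rmax_right in Hc by lra.
  pose proof (Hp c Hc). nra.
Qed.

Lemma nonincreasing_of_derive_nonpos (f df : R -> R) (a b : R) :
  a <= b ->
  (forall t, a <= t <= b -> is_derive f t (df t)) ->
  (forall t, a <= t <= b -> df t <= 0) ->
  f b <= f a.
Proof.
intros Hab Hd Hn.
assert (H : - f a <= - f b).
{ apply (nondecreasing_of_derive_nonneg (fun t => - f t) (fun t => - df t)); auto.
  - intros t Ht. apply (is_derive_opp f). now apply Hd.
  - intros t Ht. specialize (Hn t Ht). lra. }
lra.
Qed.

(** The zero is the supremum of the times up to which [f] stays positive; continuity excludes either
    strict sign there. *)
Lemma continuous_first_zero (f : R -> R) (a b : R) :
  a <= b ->
  (forall t, a <= t <= b -> continuous f t) ->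
  0 < f a -> f b <= 0 ->
  exists s, a < s <= b /\ f s = 0 /\ forall t, a <= t < s -> 0 < f t.
Proof.
intros Hab Hc Ha Hb.
set (E := fun t => a <= t <= b /\ forall r, a <= r <= t -> 0 < f r).
assert (Ea : E a).
{ split; [lra|]. intros r Hr. now replace r with a by lra. }
destruct (completeness E) as [s [Hub Hlub]].
- exists b. intros t [Ht _]. lra.
- now exists a.
- assert (Has : a <= s) by now apply Hub.
  assert (Hsb : s <= b) by (apply Hlub; intros t [Ht _]; lra).
  assert (Hpos : forall t, a <= t < s -> 0 < f t).
  { intros t Ht. apply Rnot_le_lt. intros Hft.
    assert (s <= t); [|lra].
    apply Hlub. intros r [Hr Hpr]. apply Rnot_lt_le. intros Htr.
    assert (0 < f t) by (apply Hpr; lra). lra. }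
  assert (Hnbh : forall e, 0 < e -> exists d, 0 < d /\
             forall t, Rabs (t - s) < d -> Rabs (f t - f s) < e).
  { intros e He. destruct (proj1 (filterlim_locally f (f s)) (Hc s (conj Has Hsb)) (mkposreal e He)) as [d Hd].
    exists d. split; [apply cond_pos|]. intros t Ht. exact (Hd t Ht). }
  assert (Hs0 : f s = 0).
  { destruct (Rtotal_order (f s) 0) as [Hlt|[Heq|Hgt]]; auto; exfalso.
    - destruct (Hnbh (- f s)) as [d [Hd Hn]]; [lra|].
      assert (Hne : a <> s) by (intros ->; lra).
      set (t := Rmax a (s - d / 2)).
      assert (a <= t < s /\ s - d / 2 <= t).
      { unfold t, Rmax. destruct (Rle_dec _ _); lra. }
      assert (0 < f t) by (apply Hpos; lra).
      assert (Rabs (f t - f s) < - f s) by (apply Hn, Rabs_def1; lra).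
      apply Rabs_def2 in H1. lra.
    - destruct (Hnbh (f s)) as [d [Hd Hn]]; [lra|].
      assert (s <> b) by (intros ->; lra).
      set (t := Rmin b (s + d / 2)).
      assert (s < t <= b /\ t <= s + d / 2).
      { unfold t, Rmin. destruct (Rle_dec _ _); lra. }
      assert (t <= s); [|lra].
      apply Hub. split; [lra|]. intros r Hr.
      destruct (Rlt_le_dec r s) as [Hrs|Hrs]; [apply Hpos; lra|].
      assert (Hrf : Rabs (f r - f s) < f s) by (apply Hn, Rabs_def1; lra).
      apply Rabs_def2 in Hrf. lra. }
  exists s. repeat split; auto.
  destruct (Req_dec a s) as [<-|]; lra.
Qed.

(** Companion of [continuous_first_zero]: at a first contact the left difference quotients are
    negative. A contradiction arises whenever the equation makes the derivative positive there. *)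
Lemma derive_nonpos_of_left_pos (f : R -> R) (a s l : R) :
  a < s -> is_derive f s l -> f s = 0 ->
  (forall t, a <= t < s -> 0 < f t) -> l <= 0.
Proof.
intros Has Hd Hs Hp. apply Rnot_lt_le. intros Hl.
apply is_derive_Reals in Hd.
destruct (Hd l Hl) as [d Hn].
set (h := - Rmin (d / 2) ((s - a) / 2)).
assert (Hd0 := cond_pos d).
assert (Hh : h < 0 /\ - d < h /\ a <= s + h < s).
{ unfold h, Rmin. destruct (Rle_dec _ _); lra. }
assert (Hq : Rabs ((f (s + h) - f s) / h - l) < l).
{ apply Hn; [lra|]. apply Rabs_def1; lra. }
apply Rabs_def2 in Hq.
assert (0 < f (s + h)) by (apply Hp; lra).
assert ((f (s + h) - f s) / h < 0).
{ rewrite Hs. unfold Rdiv. rewrite Rminus_0_r.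
  apply Rmult_pos_neg; [lra|]. apply Rinv_lt_0_compat; lra. }
lra.
Qed.

(* Integrating factor: [f * exp (- RInt c a)] is nondecreasing. *)
Lemma linear_comparison (f df c : R -> R) (a b : R) :
  0 < a <= b ->
  (forall t, 0 < t -> continuous c t) ->
  (forall t, 0 < t -> is_derive f t (df t)) ->
  (forall t, a <= t <= b -> c t * f t <= df t) ->
  f a * exp (RInt c a b) <= f b.
Proof.
intros Hab Hc Hd Hle.
assert (Hi : forall t, 0 < t -> is_derive (RInt c a) t (c t)).
{ intros t Ht. apply is_derive_RInt with a.
  - exists (mkposreal t Ht). intros r Hr.
    apply Rabs_def2 in Hr. simpl in Hr. unfold minus, plus, opp in Hr; simpl in Hr.
    apply RInt_correct, (ex_RInt_continuous c).
    intros z Hz. apply Hc.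
    assert (0 < Rmin a r) by (apply Rmin_glb_lt; lra). lra.
  - now apply Hc. }
assert (H : f a * exp (- RInt c a a) <= f b * exp (- RInt c a b)).
{ apply (nondecreasing_of_derive_nonneg (fun t => f t * exp (- RInt c a t))
    (fun t => (df t - c t * f t) * exp (- RInt c a t))); [lra| |].
  - intros t Ht.
    assert (H1 : is_derive (fun t => exp (- RInt c a t)) t (- c t * exp (- RInt c a t))).
    { apply (is_derive_comp exp (fun t => - RInt c a t)).
      - apply is_derive_Reals, derivable_pt_lim_exp.
      - apply (is_derive_opp (RInt c a)). apply Hi. lra. }
    assert (H2 := is_derive_mult f _ t _ _ (Hd t ltac:(lra)) H1 Rmult_comm).
    eapply is_derive_ext_loc; [|eapply eq_ind; [exact H2|]].
    + apply filter_forall. reflexivity.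
    + unfold plus, mult; simpl. ring.
  - intros t Ht. apply Rmult_le_pos; [|apply Rlt_le, exp_pos].
    specialize (Hle t Ht). lra. }
rewrite RInt_point in H. change (zero : R) with 0 in H. rewrite Ropp_0, exp_0, Rmult_1_r in H.
assert (Hp := exp_pos (RInt c a b)).
replace (f b) with (f b * exp (- RInt c a b) * exp (RInt c a b)).
- apply Rmult_le_compat_r; lra.
- rewrite Rmult_assoc, <- exp_plus. replace (- RInt c a b + RInt c a b) with 0 by ring.
  rewrite exp_0. ring.
Qed.

(** A negative value at [b] propagates backwards to a negative [f e] with [e] close to [0]. Since
    [c <= 0] near the origin, the exponential factor is at most [1] there, so [f t <= f e] for all
    smaller [t]. This is incompatible with a lower bound that tends to [0]. *)
Lemma linear_comparison_from_zero (f df c : R -> R) (b K d : R) :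
  0 < b -> 0 < d ->
  (forall t, 0 < t -> continuous c t) ->
  (forall t, 0 < t -> is_derive f t (df t)) ->
  (forall t, 0 < t <= b -> c t * f t <= df t) ->
  (forall t, 0 < t < d -> c t <= 0 /\ - K * t <= f t) ->
  0 <= f b.
Proof.
intros Hb Hd Hc Hdf Hle Hnear.
apply Rnot_lt_le. intros Hneg.
set (e := Rmin b (d / 2)).
assert (He : 0 < e <= b /\ e < d).
{ unfold e, Rmin. destruct (Rle_dec _ _); lra. }
assert (Hcmp := linear_comparison f df c e b (proj1 He) Hc Hdf).
assert (Hfe : f e < 0).
{ assert (Hx := exp_pos (RInt c e b)).
  assert (f e * exp (RInt c e b) <= f b) by (apply Hcmp; intros; apply Hle; lra).
  nra. }
assert (Hsmall : forall t, 0 < t < e -> f t <= f e).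
{ intros t Ht.
  assert (Hlt : f t * exp (RInt c t e) <= f e).
  { apply (linear_comparison f df c t e); auto; [lra|]. intros; apply Hle; lra. }
  assert (HI : RInt c t e <= 0).
  { apply Rle_trans with (RInt (fun _ => 0) t e).
    - apply RInt_le; [lra| | |].
      + apply (ex_RInt_continuous c). intros z Hz. rewrite Rmin_left in Hz by lra. apply Hc. lra.
      + apply ex_RInt_const.
      + intros z Hz. apply Hnear. lra.
    - rewrite RInt_const. unfold scal; simpl. unfold mult; simpl. lra. }
  assert (Hx := exp_pos (RInt c t e)).
  assert (exp (RInt c t e) <= 1).
  { rewrite <- exp_0. destruct HI as [HI| ->]; [left; now apply exp_increasing|right; reflexivity]. }
  assert (f t < 0) by nra. nra. }
assert (HK : 0 <= Rabs K) by apply Rabs_pos.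
(* At this [t] the lower bound [- K t] is at least [f e / 2], hence above [f e]. *)
set (t := Rmin (e / 2) (- f e / (2 * (Rabs K + 1)))).
assert (Hq : 0 < - f e / (2 * (Rabs K + 1))) by (apply Rdiv_lt_0_compat; lra).
assert (Ht : 0 < t < e /\ t <= - f e / (2 * (Rabs K + 1))).
{ unfold t, Rmin. destruct (Rle_dec _ _); lra. }
destruct Ht as [Ht1 Ht2].
assert (H1 := Hsmall t Ht1).
assert (H2 : - K * t <= f t) by (apply Hnear; lra).
assert (H3 : t * (Rabs K + 1) <= - f e / 2).
{ apply (Rmult_le_compat_r (Rabs K + 1)) in Ht2; [|lra].
  replace (- f e / (2 * (Rabs K + 1)) * (Rabs K + 1)) with (- f e / 2) in Ht2 by (field; lra).
  exact Ht2. }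
assert (K <= Rabs K) by apply Rle_abs. nra.
Qed.

(** * The profile and the derivatives of [u], [x] and [N] *)

Definition profile (Q P : R -> R) : Prop :=
  (forall t, 0 < t -> is_derive Q t (P t)) /\
  (forall t, 0 < t -> is_derive P t (Q t - Q t ^ 3 - 2 / t * P t)) /\
  filterlim Q (at_right 0) (locally (Q 0)) /\
  (forall t, 0 <= t -> 0 < Q t) /\
  is_lim Q p_infty 0.

Definition reduced (Q : R -> R) (t : R) : R := t * Q t.
Definition dreduced (Q P : R -> R) (t : R) : R := Q t + t * P t.
Definition slope (Q P : R -> R) (t : R) : R := - (t * P t / Q t).
Definition excess (Q : R -> R) (t : R) : R := t ^ 2 * (Q t ^ 2 - 1).

Lemma profile_pos (Q P : R -> R) (t : R) : profile Q P -> 0 <= t -> 0 < Q t.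
Proof. intros (_ & _ & _ & H & _). apply H. Qed.

Ltac prof_derive HQ Ht :=
  let H1 := fresh in let H2 := fresh in let H3 := fresh in
  pose proof (proj1 HQ _ Ht) as H1;
  pose proof (proj1 (proj2 HQ) _ Ht) as H2;
  pose proof (profile_pos _ _ _ HQ (Rlt_le _ _ Ht)) as H3;
  match type of HQ with profile ?Q ?P =>
    auto_derive;
    [ repeat split; try (eexists; eassumption); try lra
    | change (fun x : R => Q x) with Q; change (fun x : R => P x) with P;
      rewrite ?(is_derive_unique _ _ _ H1), ?(is_derive_unique _ _ _ H2);
      try (field; lra) ]
  end.

Lemma is_derive_reduced (Q P : R -> R) (t : R) :
  profile Q P -> 0 < t -> is_derive (reduced Q) t (dreduced Q P t).
Proof.
intros HQ Ht. unfold reduced, dreduced. prof_derive HQ Ht.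
Qed.

Lemma is_derive_dreduced (Q P : R -> R) (t : R) :
  profile Q P -> 0 < t ->
  is_derive (dreduced Q P) t (reduced Q t * (1 - Q t ^ 2)).
Proof.
intros HQ Ht. unfold reduced, dreduced. prof_derive HQ Ht.
Qed.

Lemma is_derive_slope (Q P : R -> R) (t : R) :
  profile Q P -> 0 < t ->
  is_derive (slope Q P) t ((slope Q P t ^ 2 - slope Q P t + excess Q t) / t).
Proof.
intros HQ Ht. unfold slope, excess. prof_derive HQ Ht.
Qed.

Lemma is_derive_excess (Q P : R -> R) (t : R) :
  profile Q P -> 0 < t ->
  is_derive (excess Q) t
    ((2 * excess Q t - 2 * slope Q P t * (excess Q t + t ^ 2)) / t).
Proof.
intros HQ Ht. unfold slope, excess. prof_derive HQ Ht.
Qed.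

Lemma dreduced_slope (Q P : R -> R) (t : R) :
  profile Q P -> 0 < t -> t * dreduced Q P t = reduced Q t * (1 - slope Q P t).
Proof.
intros HQ Ht. assert (Hp := profile_pos Q P t HQ (Rlt_le _ _ Ht)).
unfold dreduced, reduced, slope. field. lra.
Qed.

Lemma reduced_sqr (Q : R -> R) (t : R) : reduced Q t ^ 2 = excess Q t + t ^ 2.
Proof. unfold reduced, excess. ring. Qed.

(** * Behaviour of [Q] at infinity and of [Q], [Q'] at the origin *)

Lemma profile_small_at_infinity (Q P : R -> R) (e : R) :
  profile Q P -> 0 < e -> exists T, 0 < T /\ forall t, T <= t -> Q t < e.
Proof.
intros (_ & _ & _ & _ & HL) He.
apply is_lim_spec in HL. simpl in HL.
destruct (HL (mkposreal e He)) as [T HT].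
exists (Rmax 1 (T + 1)). split.
- apply Rlt_le_trans with 1; [lra|apply Rmax_l].
- intros t Ht. assert (T + 1 <= t) by (eapply Rle_trans; [apply Rmax_r|exact Ht]).
  assert (HTt := HT t ltac:(lra)). simpl in HTt. apply Rabs_def2 in HTt. lra.
Qed.

Lemma profile_bounded_near_zero (Q P : R -> R) :
  profile Q P -> exists d, 0 < d <= 1 /\
  forall t, 0 < t < d -> Q 0 / 2 < Q t < Q 0 + 1.
Proof.
intros HQ. assert (H0 := profile_pos Q P 0 HQ (Rle_refl _)).
destruct HQ as (_ & _ & HL & _).
assert (He : 0 < Rmin (Q 0 / 2) 1) by (apply Rmin_glb_lt; lra).
destruct (proj1 (filterlim_locally Q (Q 0)) HL (mkposreal _ He)) as [d Hd].
assert (Hd0 := cond_pos d).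
exists (Rmin d 1). split; [unfold Rmin; destruct (Rle_dec _ _); lra|].
intros t Ht.
assert (Ht' : t < d /\ t < 1) by (revert Ht; unfold Rmin; destruct (Rle_dec _ _); lra).
assert (HB : Rabs (Q t - Q 0) < Rmin (Q 0 / 2) 1).
{ apply (Hd t); [|lra]. apply Rabs_def1; unfold minus, plus, opp; simpl; lra. }
apply Rabs_def2 in HB. revert HB. unfold Rmin; destruct (Rle_dec _ _); lra.
Qed.

(* [t^2 Q'] has a derivative of size [O(t^2)], and it vanishes at the origin
   because otherwise [Q] would behave like a multiple of [1/t]. *)
Lemma profile_derive_near_zero (Q P : R -> R) :
  profile Q P -> exists d M, 0 < d <= 1 /\ 0 < M /\
  forall t, 0 < t < d -> Rabs (P t) <= M * t /\ Q 0 / 2 < Q t < M.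
Proof.
intros HQ. assert (H0 := profile_pos Q P 0 HQ (Rle_refl _)).
destruct (profile_bounded_near_zero Q P HQ) as [d [Hd HB]].
set (b := Q 0 + 1) in *.
set (M := b + b ^ 3).
assert (Hb : 1 < b) by (unfold b; lra).
assert (HM : b < M) by (unfold M; nra).
assert (HM' : forall t, 0 < t < d -> - M <= Q t - Q t ^ 3 <= M).
{ intros t Ht. destruct (HB t Ht) as [Hl Hu].
  assert (0 < Q t ^ 3 < b ^ 3).
  { split; [apply pow_lt; lra|]. simpl. rewrite !Rmult_1_r.
    apply Rmult_gt_0_lt_compat; try nra. }
  unfold M. lra. }
assert (Hv : forall t, 0 < t -> is_derive (fun t => t ^ 2 * P t) t (t ^ 2 * (Q t - Q t ^ 3))).
{ intros t Ht. prof_derive HQ Ht. }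
assert (Hup : forall t, 0 < t < d -> t ^ 2 * P t <= M * t ^ 3).
{ intros t1 Ht1. apply Rnot_lt_le. intros Hlt.
  (* [t^2 P - M t^3] is nonincreasing, so it stays at least [eta] down to the origin. Then
     [Q + eta / t] is nondecreasing, and [Q <= c - eta / t] contradicts positivity for small [t]. *)
  set (eta := t1 ^ 2 * P t1 - M * t1 ^ 3).
  assert (Heta : 0 < eta) by (unfold eta; lra).
  assert (HP : forall t, 0 < t <= t1 -> eta / t ^ 2 <= P t).
  { intros t Ht.
    assert (Hm : t1 ^ 2 * P t1 - M * t1 ^ 3 <= t ^ 2 * P t - M * t ^ 3).
    { apply (nonincreasing_of_derive_nonpos (fun t => t ^ 2 * P t - M * t ^ 3)
        (fun t => t ^ 2 * (Q t - Q t ^ 3) - M * (3 * t ^ 2))); [lra| |].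
      - intros r Hr. apply (is_derive_minus (fun t => t ^ 2 * P t) (fun t => M * t ^ 3)).
        + apply Hv; lra.
        + auto_derive; [easy|ring].
      - intros r Hr. assert (Hr' := HM' r ltac:(lra)). nra. }
    fold eta in Hm.
    assert (0 < t ^ 3) by (apply pow_lt; lra).
    assert (0 < t ^ 2) by (apply pow_lt; lra).
    apply Rmult_le_reg_r with (t ^ 2); [lra|].
    replace (eta / t ^ 2 * t ^ 2) with eta by (field; lra). nra. }
  set (c := Q t1 + eta / t1).
  assert (Hc : forall t, 0 < t <= t1 -> eta < c * t).
  { intros t Ht.
    assert (Hm : Q t + eta / t <= c).
    { apply (nondecreasing_of_derive_nonneg (fun t => Q t + eta / t)
        (fun t => P t - eta / t ^ 2)); [lra| |].
      - intros r Hr. assert (Hr0 : 0 < r) by lra. prof_derive HQ Hr0.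
      - intros r Hr. assert (Hr' := HP r ltac:(lra)). lra. }
    assert (HQt := profile_pos Q P t HQ ltac:(lra)).
    assert (eta / t < c) by lra.
    apply (Rmult_lt_compat_r t) in H; [|lra].
    replace (eta / t * t) with eta in H by (field; lra). lra. }
  assert (Hc1 := Hc t1 ltac:(lra)).
  assert (Hcpos : 0 < c) by nra.
  assert (Ht2 : 0 < Rmin t1 (eta / c) <= t1).
  { assert (0 < eta / c) by (apply Rdiv_lt_0_compat; lra).
    unfold Rmin; destruct (Rle_dec _ _); lra. }
  assert (Hc2 := Hc _ Ht2).
  assert (Rmin t1 (eta / c) <= eta / c) by apply Rmin_r.
  apply (Rmult_le_compat_l c) in H; [|lra].
  replace (c * (eta / c)) with eta in H by (field; lra). lra. }
assert (Hdn : forall t, 0 < t < d -> - (M * t ^ 3) <= t ^ 2 * P t).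
{ intros t1 Ht1. apply Rnot_lt_le. intros Hlt.
  (* Mirror case: now [Q - eta / t] is nonincreasing, so [Q] would grow like [eta / t] at the
     origin, against [Q < b]. *)
  set (eta := - (t1 ^ 2 * P t1) - M * t1 ^ 3).
  assert (Heta : 0 < eta) by (unfold eta; lra).
  assert (HP : forall t, 0 < t <= t1 -> P t <= - (eta / t ^ 2)).
  { intros t Ht.
    assert (Hm : t ^ 2 * P t + M * t ^ 3 <= t1 ^ 2 * P t1 + M * t1 ^ 3).
    { apply (nondecreasing_of_derive_nonneg (fun t => t ^ 2 * P t + M * t ^ 3)
        (fun t => t ^ 2 * (Q t - Q t ^ 3) + M * (3 * t ^ 2))); [lra| |].
      - intros r Hr. apply (is_derive_plus (fun t => t ^ 2 * P t) (fun t => M * t ^ 3)).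
        + apply Hv; lra.
        + auto_derive; [easy|ring].
      - intros r Hr. assert (Hr' := HM' r ltac:(lra)). nra. }
    assert (0 < t ^ 3) by (apply pow_lt; lra).
    assert (0 < t ^ 2) by (apply pow_lt; lra).
    apply Rmult_le_reg_r with (t ^ 2); [lra|].
    replace (- (eta / t ^ 2) * t ^ 2) with (- eta) by (field; lra). unfold eta; nra. }
  set (c := b + Rabs (Q t1 - eta / t1)).
  assert (Hc : forall t, 0 < t <= t1 -> eta <= c * t).
  { intros t Ht.
    assert (Hm : Q t1 - eta / t1 <= Q t - eta / t).
    { apply (nonincreasing_of_derive_nonpos (fun t => Q t - eta / t)
        (fun t => P t + eta / t ^ 2)); [lra| |].
      - intros r Hr. assert (Hr0 : 0 < r) by lra. prof_derive HQ Hr0.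
      - intros r Hr. assert (Hr' := HP r ltac:(lra)). lra. }
    assert (HQt := HB t ltac:(lra)).
    assert (Ha := Rle_abs (- (Q t1 - eta / t1))). rewrite Rabs_Ropp in Ha.
    assert (eta / t <= c) by (unfold c; lra).
    apply (Rmult_le_compat_r t) in H; [|lra].
    replace (eta / t * t) with eta in H by (field; lra). lra. }
  assert (Hcpos : 0 < c) by (unfold c; assert (Ha := Rabs_pos (Q t1 - eta / t1)); lra).
  assert (Ht2 : 0 < Rmin t1 (eta / (2 * c)) <= t1).
  { assert (0 < eta / (2 * c)) by (apply Rdiv_lt_0_compat; lra).
    unfold Rmin; destruct (Rle_dec _ _); lra. }
  assert (Hc2 := Hc _ Ht2).
  assert (Rmin t1 (eta / (2 * c)) <= eta / (2 * c)) by apply Rmin_r.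
  apply (Rmult_le_compat_l c) in H; [|lra].
  replace (c * (eta / (2 * c))) with (eta / 2) in H by (field; lra). lra. }
exists d, M. repeat split; try lra.
- assert (Ht2 : 0 < t ^ 2) by (apply pow_lt; lra).
  assert (H1 := Hup t H). assert (H2 := Hdn t H).
  replace (M * t ^ 3) with (t ^ 2 * (M * t)) in H1, H2 by ring.
  apply Rabs_le. split; apply Rmult_le_reg_l with (t ^ 2); lra.
- now apply HB.
- assert (Hq := HB t H). lra.
Qed.

(** * Energy of [Q], its monotonicity, and the size of [x] and [N] near the origin *)

Lemma is_derive_continuous (f : R -> R) (t l : R) : is_derive f t l -> continuous f t.
Proof.
intros H. apply (ex_derive_continuous (V := R_NormedModule)). now exists l.
Qed.

(** The energy has derivative [- (2 / t) P^2]. If it were negative once, it would stay below a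
    negative constant, whereas it is at least [- Q^2 / 2], which tends to [0]. *)
Lemma energy_nonneg (Q P : R -> R) (t : R) :
  profile Q P -> 0 < t -> 0 <= P t ^ 2 / 2 - Q t ^ 2 / 2 + Q t ^ 4 / 4.
Proof.
intros HQ Ht. apply Rnot_lt_le. intros Hneg.
set (E := fun t => P t ^ 2 / 2 - Q t ^ 2 / 2 + Q t ^ 4 / 4).
assert (Hc : 0 < Rmin 1 (- E t)) by (apply Rmin_glb_lt; unfold E; lra).
destruct (profile_small_at_infinity Q P _ HQ Hc) as [T [HT Hs]].
set (r := Rmax t T).
assert (Hr : t <= r /\ T <= r) by (split; [apply Rmax_l|apply Rmax_r]).
assert (Hmon : E r <= E t).
{ apply (nonincreasing_of_derive_nonpos E (fun t => - (2 / t * P t ^ 2))); [lra| |].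
  - intros q Hq. assert (Hq0 : 0 < q) by lra. unfold E. prof_derive HQ Hq0.
  - intros q Hq. assert (0 < 2 / q) by (apply Rdiv_lt_0_compat; lra).
    assert (0 <= P q ^ 2) by apply pow2_ge_0. nra. }
assert (HQr := Hs r (proj2 Hr)).
assert (HQp := profile_pos Q P r HQ ltac:(lra)).
assert (Q r < 1 /\ Q r < - E t).
{ revert HQr. unfold Rmin; destruct (Rle_dec _ _); lra. }
assert (0 <= P r ^ 2) by apply pow2_ge_0.
assert (0 <= Q r ^ 4) by (apply pow_le; lra).
assert (Q r ^ 2 < Q r * 1) by (simpl; nra).
unfold E in *. lra.
Qed.

(* At a critical point nonnegativity of the energy forces [Q >= sqrt 2], so
   that [Q'' = Q - Q^3 < 0] there and [Q'] can only cross zero downwards. *)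
Lemma profile_derive_neg (Q P : R -> R) (t : R) :
  profile Q P -> 0 < t -> P t < 0.
Proof.
intros HQ Ht. apply Rnot_le_lt. intros Hge.
assert (HQ' := HQ). destruct HQ' as (HdQ & HdP & _).
assert (Hcrit : forall s, 0 < s -> P s = 0 -> Q s - Q s ^ 3 - 2 / s * P s < 0).
{ intros s Hs HP. assert (HE := energy_nonneg Q P s HQ Hs).
  assert (Hq := profile_pos Q P s HQ ltac:(lra)). rewrite HP in *.
  assert (0 <= Q s ^ 2 * (Q s ^ 2 - 2)) by nra.
  assert (0 < Q s ^ 2) by (apply pow_lt; lra).
  assert (2 <= Q s ^ 2) by nra.
  replace (Q s - Q s ^ 3 - 2 / s * 0) with (Q s * (1 - Q s ^ 2)) by ring. nra. }
assert (HcP : forall s, 0 < s -> continuous P s).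
{ intros s Hs. eapply is_derive_continuous, HdP; auto. }
(* If [P] vanishes before [t], [Hcrit] makes it negative just afterwards. From a negative value,
   reaching [P t >= 0] would require an upward crossing, which [Hcrit] forbids. *)
assert (Hback : forall s, 0 < s < t -> 0 < P s).
{ intros s Hs. apply Rnot_le_lt. intros Hle.
  assert (Hneg : exists r, 0 < r < t /\ P r < 0).
  { destruct Hle as [Hlt|Heq]; [now exists s|].
    destruct (Rlt_le_dec (P ((s + t) / 2)) 0) as [Hm|Hm]; [exists ((s + t) / 2); lra|].
    assert (Hd := HdP s (proj1 Hs)). assert (Hc := Hcrit s (proj1 Hs) Heq).
    apply is_derive_Reals in Hd.
    destruct (Hd (- (Q s - Q s ^ 3 - 2 / s * P s)) ltac:(lra)) as [d Hn].
    assert (Hd0 := cond_pos d).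
    set (h := Rmin (d / 2) ((t - s) / 2)).
    assert (Hh : 0 < h < d /\ s + h < t).
    { unfold h, Rmin. destruct (Rle_dec _ _); lra. }
    exists (s + h). split; [lra|].
    assert (Hq := Hn h ltac:(lra) ltac:(apply Rabs_def1; lra)).
    apply Rabs_def2 in Hq.
    assert (Hq2 : (P (s + h) - P s) / h < 0) by lra.
    apply (Rmult_lt_compat_r h) in Hq2; [|lra].
    replace ((P (s + h) - P s) / h * h) with (P (s + h) - P s) in Hq2 by (field; lra). lra. }
  destruct Hneg as [r [Hr Hr0]].
  destruct (continuous_first_zero (fun t => - P t) r t) as [q [Hq [Hq0 Hqp]]]; try lra.
  { intros z Hz. apply (continuous_opp P). apply HcP. lra. }
  assert (Hl : - (Q q - Q q ^ 3 - 2 / q * P q) <= 0).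
  { apply (derive_nonpos_of_left_pos (fun t => - P t) r q); auto; [lra|].
    apply (is_derive_opp P). apply HdP. lra. }
  assert (Hc := Hcrit q ltac:(lra) ltac:(lra)). lra. }
destruct (profile_derive_near_zero Q P HQ) as (d & M & Hd & HM & Hnear).
assert (H0 := profile_pos Q P 0 HQ (Rle_refl _)).
assert (Hv : forall t, 0 < t -> is_derive (fun t => t ^ 2 * P t) t (t ^ 2 * (Q t - Q t ^ 3))).
{ intros s Hs. prof_derive HQ Hs. }
destruct (classic (exists r, 0 < r < Rmin t d /\ Q r < 1)) as [[r [Hr Hr1]]|Hno].
- assert (Hrt : r < t /\ r < d).
  { revert Hr. unfold Rmin; destruct (Rle_dec _ _); lra. }
  (* Here [P s <= Q 0 / 4] and [Q 0 / 2 < Q s < 1], so the energy at [s] is at most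
     [Q 0 ^ 2 / 32 - Q 0 ^ 2 / 16 < 0]. *)
  set (s := Rmin r (Q 0 / (4 * M))).
  assert (Hq : 0 < Q 0 / (4 * M)) by (apply Rdiv_lt_0_compat; lra).
  assert (Hs : 0 < s <= r /\ s <= Q 0 / (4 * M)).
  { unfold s, Rmin. destruct (Rle_dec _ _); lra. }
  assert (Hs1 : Q s < 1).
  { apply Rle_lt_trans with (Q r); [|exact Hr1].
    apply (nondecreasing_of_derive_nonneg Q P); [lra| |].
    - intros z Hz. apply HdQ. lra.
    - intros z Hz. apply Rlt_le, Hback. lra. }
  destruct (Hnear s ltac:(lra)) as [HPs HQs].
  assert (HPp := Hback s ltac:(lra)). rewrite Rabs_pos_eq in HPs by lra.
  assert (HMs : M * s <= Q 0 / 4).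
  { destruct Hs as [_ Hs]. apply (Rmult_le_compat_l M) in Hs; [|lra].
    replace (M * (Q 0 / (4 * M))) with (Q 0 / 4) in Hs by (field; lra). lra. }
  assert (HE := energy_nonneg Q P s HQ ltac:(lra)).
  assert (P s ^ 2 <= (Q 0 / 4) ^ 2) by (apply pow_incr; lra).
  assert ((Q 0 / 2) ^ 2 <= Q s ^ 2) by (apply pow_incr; lra).
  assert (Q s ^ 2 <= 1) by (simpl; nra).
  assert (0 < Q 0 ^ 2) by (apply pow_lt; lra).
  nra.
(* Now [Q >= 1] near the origin, so [t^2 P] is nonincreasing there and stays above a positive
   constant as [t] decreases to [0], against [P <= M t]. *)
- set (r := Rmin t d / 2).
  assert (Hr : 0 < r < Rmin t d).
  { assert (0 < Rmin t d) by (apply Rmin_glb_lt; lra). unfold r; lra. }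
  assert (Hrt : r < t /\ r < d).
  { revert Hr. unfold Rmin; destruct (Rle_dec _ _); lra. }
  assert (HPr := Hback r ltac:(lra)).
  assert (Hvr : 0 < r ^ 2 * P r) by (apply Rmult_lt_0_compat; [apply pow_lt|]; lra).
  assert (Hq : 0 < r ^ 2 * P r / (2 * M)) by (apply Rdiv_lt_0_compat; lra).
  set (s := Rmin r (r ^ 2 * P r / (2 * M))).
  assert (Hs : 0 < s <= r /\ s <= r ^ 2 * P r / (2 * M)).
  { unfold s, Rmin. destruct (Rle_dec _ _); lra. }
  assert (Hmon : r ^ 2 * P r <= s ^ 2 * P s).
  { apply (nonincreasing_of_derive_nonpos (fun t => t ^ 2 * P t)
      (fun t => t ^ 2 * (Q t - Q t ^ 3))); [lra| |].
    - intros z Hz. apply Hv. lra.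
    - intros z Hz.
      assert (Hz1 : 1 <= Q z).
      { apply Rnot_lt_le. intros Hz1. apply Hno. exists z. split; [lra|exact Hz1]. }
      assert (0 <= z ^ 2) by apply pow2_ge_0.
      assert (1 <= Q z ^ 2) by (simpl; nra).
      replace (Q z - Q z ^ 3) with (- (Q z * (Q z ^ 2 - 1))) by ring.
      assert (0 <= Q z * (Q z ^ 2 - 1)) by (apply Rmult_le_pos; lra).
      assert (0 <= z ^ 2 * (Q z * (Q z ^ 2 - 1))) by (apply Rmult_le_pos; lra). lra. }
  destruct (Hnear s ltac:(lra)) as [HPs _].
  assert (HPp : 0 < P s) by (apply Hback; lra). rewrite Rabs_pos_eq in HPs by lra.
  assert (HMs : M * s <= r ^ 2 * P r / 2).
  { destruct Hs as [_ Hs]. apply (Rmult_le_compat_l M) in Hs; [|lra].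
    replace (M * (r ^ 2 * P r / (2 * M))) with (r ^ 2 * P r / 2) in Hs by (field; lra). lra. }
  assert (s ^ 2 <= 1) by (simpl; nra).
  nra.
Qed.

Lemma reduced_pos (Q P : R -> R) (t : R) : profile Q P -> 0 < t -> 0 < reduced Q t.
Proof.
intros HQ Ht. assert (Hp := profile_pos Q P t HQ (Rlt_le _ _ Ht)).
unfold reduced. nra.
Qed.

Lemma slope_pos (Q P : R -> R) (t : R) : profile Q P -> 0 < t -> 0 < slope Q P t.
Proof.
intros HQ Ht. assert (Hp := profile_pos Q P t HQ (Rlt_le _ _ Ht)).
assert (HP := profile_derive_neg Q P t HQ Ht).
unfold slope. replace (- (t * P t / Q t)) with (t * - P t / Q t) by (field; lra).
apply Rdiv_lt_0_compat; nra.
Qed.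

Lemma profile_decreasing (Q P : R -> R) (s t : R) :
  profile Q P -> 0 < s <= t -> Q t <= Q s.
Proof.
intros HQ Hs. apply (nonincreasing_of_derive_nonpos Q P); [lra| |].
- intros z Hz. apply (proj1 HQ). lra.
- intros z Hz. apply Rlt_le, (profile_derive_neg Q P); [exact HQ|lra].
Qed.

(** From [|P| <= M t] and the bounds on [Q], [x] is [O(t^2)] and [N] is at most a multiple of [t^2].
    Shrinking [d] absorbs the constants into one factor [t]. *)
Lemma slope_near_zero (Q P : R -> R) :
  profile Q P -> exists d, 0 < d <= 1 / 10 /\
  forall t, 0 < t < d -> slope Q P t <= t / 10 /\ excess Q t <= t / 10.
Proof.
intros HQ. destruct (profile_derive_near_zero Q P HQ) as (d & M & Hd & HM & Hnear).
assert (H0 := profile_pos Q P 0 HQ (Rle_refl _)).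
set (K := 2 * M / Q 0 + M ^ 2).
assert (HK1 : 0 < 2 * M / Q 0) by (apply Rdiv_lt_0_compat; lra).
assert (HK : 0 < K) by (unfold K; nra).
assert (He0 : 0 < / (10 * (K + 1))) by (apply Rinv_0_lt_compat; lra).
set (e := Rmin d (/ (10 * (K + 1)))).
assert (He : 0 < e /\ e <= d /\ e <= / (10 * (K + 1))).
{ unfold e, Rmin. destruct (Rle_dec _ _); lra. }
assert (HKe : / (10 * (K + 1)) * (K + 1) = 1 / 10) by (field; lra).
exists e. split; [nra|]. intros t Ht.
destruct (Hnear t ltac:(lra)) as [HP HQt].
assert (HKt : K * t <= 1 / 10) by nra. split.
- assert (HPn := profile_derive_neg Q P t HQ ltac:(lra)).
  rewrite Rabs_left in HP by lra.
  apply Rle_trans with (2 * M / Q 0 * t * t); [|assert (0 <= M ^ 2 * t) by nra; unfold K in HKt; nra].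
  unfold slope. apply Rmult_le_reg_r with (Q t); [lra|].
  replace (- (t * P t / Q t) * Q t) with (t * - P t) by (field; lra).
  assert (2 * M / Q 0 * (Q 0 / 2) = M) by (field; lra).
  assert (M <= 2 * M / Q 0 * Q t) by nra.
  assert (t * - P t <= t * (M * t)) by (apply Rmult_le_compat_l; lra).
  nra.
- assert (Q t ^ 2 <= M ^ 2) by (apply pow_incr; lra).
  assert (0 <= 2 * M / Q 0 * t) by nra.
  assert (M ^ 2 * t <= 1 / 10) by (unfold K in HKt; nra).
  unfold excess. nra.
Qed.

(** * Decay of [u] and [u'], and the constraints valid for all [t > 0] *)

(** Once [Q < 1/2], [u'' >= u / 2], so [u] is convex. If [u'] were ever nonnegative, [u] would grow
    at least linearly, against [u / t -> 0]; hence [u' < 0]. If [u] stayed above [e], [u'] would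
    become nonnegative; if [u'] stayed below [- e], [u] would become negative. *)
Lemma reduced_vanishes_at_infinity (Q P : R -> R) :
  profile Q P -> forall e, 0 < e -> exists T, 0 < T /\
  forall t, T <= t -> reduced Q t < e /\ - e < dreduced Q P t < 0.
Proof.
intros HQ.
destruct (profile_small_at_infinity Q P (1 / 2) HQ ltac:(lra)) as [T [HT Hs]].
assert (Hconv : forall t, T <= t -> reduced Q t / 2 <= reduced Q t * (1 - Q t ^ 2)).
{ intros t Ht. assert (Hu := reduced_pos Q P t HQ ltac:(lra)).
  assert (HQt := profile_pos Q P t HQ ltac:(lra)). assert (Hq := Hs t Ht).
  assert (Q t ^ 2 <= 1 / 2) by (simpl; nra). nra. }
assert (Hdd : forall s t, T <= s <= t -> dreduced Q P s <= dreduced Q P t).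
{ intros s t Hst.
  apply (nondecreasing_of_derive_nonneg _ (fun t => reduced Q t * (1 - Q t ^ 2))); [lra| |].
  - intros z Hz. apply is_derive_dreduced; [exact HQ|lra].
  - intros z Hz. assert (Hu := reduced_pos Q P z HQ ltac:(lra)).
    assert (Hc := Hconv z ltac:(lra)). lra. }
assert (Hlin : forall s l, T <= s -> (forall t, s <= t -> l <= dreduced Q P t) ->
          forall t, s <= t -> reduced Q s + l * (t - s) <= reduced Q t).
{ intros s l Hs0 Hl t Ht.
  assert (Hm : reduced Q s - l * s <= reduced Q t - l * t); [|lra].
  apply (nondecreasing_of_derive_nonneg (fun t => reduced Q t - l * t)
    (fun t => dreduced Q P t - l)); [lra| |].
  - intros z Hz. apply (is_derive_minus (reduced Q) (fun t => l * t)).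
    + apply is_derive_reduced; [exact HQ|lra].
    + auto_derive; [easy|ring].
  - intros z Hz. assert (Hlz := Hl z ltac:(lra)). lra. }
assert (Hdlin : forall s l, T <= s -> (forall t, s <= t -> l <= reduced Q t) ->
          forall t, s <= t -> dreduced Q P s + l / 2 * (t - s) <= dreduced Q P t).
{ intros s l Hs0 Hl t Ht.
  assert (Hm : dreduced Q P s - l / 2 * s <= dreduced Q P t - l / 2 * t); [|lra].
  apply (nondecreasing_of_derive_nonneg (fun t => dreduced Q P t - l / 2 * t)
    (fun t => reduced Q t * (1 - Q t ^ 2) - l / 2)); [lra| |].
  - intros z Hz. apply (is_derive_minus (dreduced Q P) (fun t => l / 2 * t)).
    + apply is_derive_dreduced; [exact HQ|lra].
    + auto_derive; [easy|field].
  - intros z Hz. assert (Hlz := Hl z ltac:(lra)). assert (Hc := Hconv z ltac:(lra)). lra. }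
assert (Hposd : forall t l, T <= t -> 0 < l -> l <= dreduced Q P t -> False).
{ intros t l Ht Hl Hd.
  destruct (profile_small_at_infinity Q P (l / 2) HQ ltac:(lra)) as [T2 [HT2 Hs2]].
  set (r := 2 * Rmax t T2).
  assert (Hr : t <= Rmax t T2 /\ T2 <= Rmax t T2) by (split; [apply Rmax_l|apply Rmax_r]).
  assert (H1 := Hlin t l Ht (fun z Hz => Rle_trans _ _ _ Hd (Hdd t z ltac:(lra))) r ltac:(unfold r; lra)).
  assert (H2 := Hs2 r ltac:(unfold r; lra)).
  assert (H3 := reduced_pos Q P t HQ ltac:(lra)).
  unfold reduced in H1, H3. unfold r in *. nra. }
assert (Hneg : forall t, T <= t -> dreduced Q P t < 0).
{ intros t Ht. apply Rnot_le_lt. intros Hge.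
  assert (Hu := reduced_pos Q P t HQ ltac:(lra)).
  apply (Hposd (t + 1) (reduced Q t / 2)); [lra|lra|].
  assert (H1 := Hdlin t (reduced Q t) Ht).
  assert (H2 : forall z, t <= z -> reduced Q t <= reduced Q z).
  { intros z Hz. assert (H3 := Hlin t 0 Ht (fun z Hz => Rle_trans _ _ _ Hge (Hdd t z ltac:(lra))) z Hz). lra. }
  specialize (H1 H2 (t + 1) ltac:(lra)). lra. }
assert (Hdecr : forall s t, T <= s <= t -> reduced Q t <= reduced Q s).
{ intros s t Hst. apply (nonincreasing_of_derive_nonpos _ (dreduced Q P)); [lra| |].
  - intros z Hz. apply is_derive_reduced; [exact HQ|lra].
  - intros z Hz. apply Rlt_le, Hneg. lra. }
intros e He.
assert (H1 : exists s, T <= s /\ reduced Q s < e).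
{ apply NNPP. intros Hno.
  assert (Hge : forall t, T <= t -> e <= reduced Q t).
  { intros t Ht. apply Rnot_lt_le. intros Hlt. apply Hno. now exists t. }
  set (r := T + 2 * - dreduced Q P T / e).
  assert (HdT := Hneg T (Rle_refl _)).
  assert (Hr : 0 < 2 * - dreduced Q P T / e) by (apply Rdiv_lt_0_compat; lra).
  assert (H1 := Hdlin T e (Rle_refl _) Hge r ltac:(unfold r; lra)).
  assert (H2 := Hneg r ltac:(unfold r; lra)).
  replace (e / 2 * (r - T)) with (- dreduced Q P T) in H1 by (unfold r; field; lra). lra. }
assert (H2 : exists s, T <= s /\ - e < dreduced Q P s).
{ apply NNPP. intros Hno.
  assert (Hle : forall t, T <= t -> dreduced Q P t <= - e).
  { intros t Ht. apply Rnot_lt_le. intros Hlt. apply Hno. now exists t. }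
  set (r := T + reduced Q T / e).
  assert (HuT := reduced_pos Q P T HQ HT).
  assert (Hr : 0 < reduced Q T / e) by (apply Rdiv_lt_0_compat; lra).
  assert (H2 : reduced Q r + e * r <= reduced Q T + e * T).
  { apply (nonincreasing_of_derive_nonpos (fun t => reduced Q t + e * t)
      (fun t => dreduced Q P t + e)); [unfold r; lra| |].
    - intros z Hz. apply (is_derive_plus (reduced Q) (fun t => e * t)).
      + apply is_derive_reduced; [exact HQ|lra].
      + auto_derive; [easy|ring].
    - intros z Hz. assert (Hz' := Hle z ltac:(lra)). lra. }
  assert (Hur := reduced_pos Q P r HQ ltac:(unfold r; lra)).
  replace (e * r) with (e * T + reduced Q T) in H2 by (unfold r; field; lra). lra. }
destruct H1 as [s1 [Hs1 Hs1']], H2 as [s2 [Hs2 Hs2']].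
exists (Rmax s1 s2).
assert (Hm1 := Rmax_l s1 s2). assert (Hm2 := Rmax_r s1 s2).
split; [lra|]. intros t Ht. repeat split.
- apply Rle_lt_trans with (reduced Q s1); [apply Hdecr; lra|exact Hs1'].
- apply Rlt_le_trans with (dreduced Q P s2); [exact Hs2'|apply Hdd; lra].
- apply Hneg. lra.
Qed.

(** Along the equation only the explicit [t] in [u^4 / (2 t^2)] contributes to the derivative, which
    is [- t Q^4]. As for [energy_nonneg], a negative value would persist although [u -> 0]. *)
Lemma reduced_energy_nonneg (Q P : R -> R) (t : R) :
  profile Q P -> 0 < t ->
  0 <= dreduced Q P t ^ 2 - reduced Q t ^ 2 * (1 - Q t ^ 2 / 2).
Proof.
intros HQ Ht. apply Rnot_lt_le. intros Hneg.
set (F := fun t => dreduced Q P t ^ 2 - reduced Q t ^ 2 * (1 - Q t ^ 2 / 2)) in *.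
assert (Hc : 0 < Rmin 1 (- F t)) by (apply Rmin_glb_lt; unfold F; lra).
destruct (reduced_vanishes_at_infinity Q P HQ _ Hc) as [T [HT Hs]].
set (r := Rmax t T).
assert (Hr : t <= r /\ T <= r) by (split; [apply Rmax_l|apply Rmax_r]).
assert (Hmon : F r <= F t).
{ apply (nonincreasing_of_derive_nonpos F (fun t => - (t * Q t ^ 4))); [lra| |].
  - intros q Hq. assert (Hq0 : 0 < q) by lra. unfold F, dreduced, reduced. prof_derive HQ Hq0.
  - intros q Hq. assert (0 < Q q ^ 4) by (apply pow_lt, (profile_pos Q P); [exact HQ|lra]). nra. }
destruct (Hs r (proj2 Hr)) as [Hur _].
assert (Hup := reduced_pos Q P r HQ ltac:(lra)).
assert (reduced Q r < 1 /\ reduced Q r < - F t).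
{ revert Hur. unfold Rmin; destruct (Rle_dec _ _); lra. }
assert (0 <= dreduced Q P r ^ 2) by apply pow2_ge_0.
assert (0 <= reduced Q r ^ 2 * Q r ^ 2) by (apply Rmult_le_pos; apply pow2_ge_0).
assert (reduced Q r ^ 2 < reduced Q r * 1) by (simpl; nra).
unfold F in *. lra.
Qed.

(* [u + u'] is driven down at the rate [u^3/t^2] and must stay positive; the
   subtracted term accounts for the part of this decay still to come, estimated
   with [u (s) >= u (t) exp (t - s)]. *)
Lemma reduced_plus_derive_lower_bound (Q P : R -> R) (t : R) :
  profile Q P -> 0 < t ->
  0 <= reduced Q t + dreduced Q P t - reduced Q t ^ 3 / (t * (2 + 4 * t)).
Proof.
intros HQ Ht. apply Rnot_lt_le. intros Hneg.
(* A failure of the bound means [K t > 0]. The inequality [K' >= c K] preserves positivity, and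
   [c >= 0] once [Q < 1/2], so [K] is bounded below by [K r > 0]. For large [s], however,
   [u^3 / (s (2 + 4 s)) <= u], so [K s <= - u' s], which tends to [0]. *)
set (K := fun t => - (reduced Q t + dreduced Q P t - reduced Q t ^ 3 / (t * (2 + 4 * t)))).
set (c := fun t => 1 - 3 * Q t ^ 2 * t / (2 + 4 * t)).
set (dK := fun t => - (reduced Q t + dreduced Q P t - t * Q t ^ 3
   - (3 * reduced Q t ^ 2 * dreduced Q P t / (t * (2 + 4 * t))
      - reduced Q t ^ 3 * (2 + 8 * t) / (t * (2 + 4 * t)) ^ 2))).
assert (HdK : forall s, 0 < s -> is_derive K s (dK s)).
{ intros s Hs. unfold K, dK, reduced, dreduced.
  assert (s * (2 + 4 * s) <> 0) by nra.
  prof_derive HQ Hs. }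
assert (Hcc : forall s, 0 < s -> continuous c s).
{ intros s Hs. apply (ex_derive_continuous (V := R_NormedModule)).
  assert (H1 := proj1 HQ s Hs). unfold c. auto_derive.
  repeat split; [now exists (P s)|lra]. }
assert (Hle : forall s, 0 < s -> c s * K s <= dK s).
{ intros s Hs.
  assert (Heq : dK s - c s * K s =
     Q s ^ 3 * s ^ 3 * (2 / (s * (2 + 4 * s)) ^ 2 + 3 * Q s ^ 2 * s ^ 2 / (s * (2 + 4 * s)) ^ 2)).
  { unfold dK, c, K, reduced, dreduced. field. lra. }
  assert (Hq := profile_pos Q P s HQ ltac:(lra)).
  assert (0 < s * (2 + 4 * s)) by nra.
  assert (0 <= dK s - c s * K s); [|lra].
  rewrite Heq.
  apply Rmult_le_pos; [apply Rmult_le_pos; apply pow_le; lra|].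
  apply Rplus_le_le_0_compat; apply Rdiv_le_0_compat; try lra; try (apply pow_lt; lra).
  apply Rmult_le_pos; [apply Rmult_le_pos; [lra|]|]; apply pow_le; lra. }
destruct (profile_small_at_infinity Q P (1 / 2) HQ ltac:(lra)) as [T [HT Hs]].
set (r := Rmax t T).
assert (Hr : t <= r /\ T <= r) by (split; [apply Rmax_l|apply Rmax_r]).
assert (HKr : 0 < K r).
{ assert (H1 := linear_comparison K dK c t r ltac:(lra) Hcc HdK (fun s Hs => Hle s ltac:(lra))).
  assert (0 < K t) by (unfold K; lra).
  assert (Hx := exp_pos (RInt c t r)). nra. }
assert (Hinc : forall s, r <= s -> K r <= K s).
{ intros s Hrs.
  assert (H1 := linear_comparison K dK c r s ltac:(lra) Hcc HdK (fun s Hs => Hle s ltac:(lra))).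
  assert (HI : 0 <= RInt c r s).
  { apply RInt_ge_0; [lra| |].
    - apply (ex_RInt_continuous c). intros z Hz. rewrite Rmin_left in Hz by lra. apply Hcc. lra.
    - intros z Hz. unfold c.
      assert (Hq := Hs z ltac:(lra)). assert (Hq0 := profile_pos Q P z HQ ltac:(lra)).
      assert (Q z ^ 2 <= 1 / 4) by (simpl; nra).
      assert (3 * Q z ^ 2 * z / (2 + 4 * z) <= 1); [|lra].
      apply Rmult_le_reg_r with (2 + 4 * z); [lra|].
      unfold Rdiv. rewrite Rmult_assoc, Rinv_l by lra. nra. }
  assert (1 <= exp (RInt c r s)).
  { rewrite <- exp_0. destruct HI as [HI| <-]; [left; now apply exp_increasing|right; reflexivity]. }
  nra. }
set (e := Rmin (1 / 2) (K r / 4)).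
assert (He : 0 < e /\ e <= 1 / 2 /\ e <= K r / 4).
{ unfold e, Rmin. destruct (Rle_dec _ _); lra. }
destruct (reduced_vanishes_at_infinity Q P HQ e (proj1 He)) as [T2 [HT2 Hs2]].
set (s := Rmax (r + 1) T2).
assert (Hsr : r + 1 <= s /\ T2 <= s) by (split; [apply Rmax_l|apply Rmax_r]).
assert (H1 := Hinc s ltac:(lra)). destruct (Hs2 s ltac:(lra)) as [H2 H3].
assert (H4 := reduced_pos Q P s HQ ltac:(lra)).
assert (H5 : reduced Q s ^ 3 / (s * (2 + 4 * s)) <= reduced Q s).
{ assert (1 <= s) by (assert (0 < t) by lra; lra).
  assert (0 < s * (2 + 4 * s)) by nra.
  apply Rmult_le_reg_r with (s * (2 + 4 * s)); [lra|].
  unfold Rdiv. rewrite Rmult_assoc, Rinv_l by lra.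
  assert (reduced Q s ^ 2 <= 1) by (simpl; nra).
  replace (reduced Q s ^ 3) with (reduced Q s * reduced Q s ^ 2) by ring. nra. }
unfold K at 2 in H1. lra.
Qed.

(** The preceding constraint divided by [u], with [t u' = u (1 - x)] and [u^2 = N + t^2]. *)
Lemma slope_upper_bound (Q P : R -> R) (t : R) :
  profile Q P -> 0 < t ->
  excess Q t + t ^ 2 <= (2 + 4 * t) * (1 + t - slope Q P t).
Proof.
intros HQ Ht. assert (HK := reduced_plus_derive_lower_bound Q P t HQ Ht).
assert (Hu := reduced_pos Q P t HQ Ht).
assert (Hd := dreduced_slope Q P t HQ Ht).
rewrite <- reduced_sqr.
apply Rmult_le_reg_l with (reduced Q t); [exact Hu|].
replace (reduced Q t * ((2 + 4 * t) * (1 + t - slope Q P t)))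
  with ((2 + 4 * t) * (reduced Q t * t + reduced Q t * (1 - slope Q P t))) by ring.
rewrite <- Hd.
assert (0 < t * (2 + 4 * t)) by nra.
apply (Rmult_le_compat_r (t * (2 + 4 * t))) in HK; [|lra].
replace ((reduced Q t + dreduced Q P t - reduced Q t ^ 3 / (t * (2 + 4 * t))) * (t * (2 + 4 * t)))
  with ((reduced Q t + dreduced Q P t) * (t * (2 + 4 * t)) - reduced Q t ^ 3) in HK by (field; lra).
nra.
Qed.

Lemma slope_lt (Q P : R -> R) (t : R) :
  profile Q P -> 0 < t -> slope Q P t < 1 + t.
Proof.
intros HQ Ht. assert (H := slope_upper_bound Q P t HQ Ht).
assert (Hu := reduced_pos Q P t HQ Ht).
rewrite <- reduced_sqr in H. assert (0 < reduced Q t ^ 2) by (apply pow_lt; lra).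
nra.
Qed.

(** The reduced energy multiplied by [2 t^2 / u^2], with the same substitutions. *)
Lemma slope_energy (Q P : R -> R) (t : R) :
  profile Q P -> 0 < t ->
  t ^ 2 <= 2 * (1 - slope Q P t) ^ 2 + excess Q t.
Proof.
intros HQ Ht. assert (HF := reduced_energy_nonneg Q P t HQ Ht).
assert (Hu := reduced_pos Q P t HQ Ht).
assert (Hd := dreduced_slope Q P t HQ Ht).
assert (Hu2 : 0 < reduced Q t ^ 2) by (apply pow_lt; lra).
assert (H : 0 <= t ^ 2 * (dreduced Q P t ^ 2 - reduced Q t ^ 2 * (1 - Q t ^ 2 / 2))).
{ apply Rmult_le_pos; [apply pow2_ge_0|exact HF]. }
replace (t ^ 2 * (dreduced Q P t ^ 2 - reduced Q t ^ 2 * (1 - Q t ^ 2 / 2)))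
  with ((t * dreduced Q P t) ^ 2 - reduced Q t ^ 2 * (t ^ 2 - t ^ 2 * Q t ^ 2 / 2)) in H by field.
rewrite Hd in H.
replace (t ^ 2 * Q t ^ 2) with (excess Q t + t ^ 2) in H by (unfold excess; ring).
apply Rmult_le_reg_l with (reduced Q t ^ 2); [exact Hu2|]. nra.
Qed.

(* Where [Q < sqrt 2] the reduced energy keeps [u'] away from zero, and its
   sign is the one it has near infinity. *)
Lemma dreduced_upper_bound (Q P : R -> R) (t r : R) :
  profile Q P -> 0 < t -> Q t ^ 2 < 2 -> 0 <= r -> r ^ 2 <= 1 - Q t ^ 2 / 2 ->
  dreduced Q P t <= - (r * reduced Q t) /\ dreduced Q P t < 0.
Proof.
intros HQ Ht HQ2 Hr Hr2.
assert (Hneg : dreduced Q P t < 0).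
{ apply Rnot_le_lt. intros Hge.
  destruct (reduced_vanishes_at_infinity Q P HQ 1 ltac:(lra)) as [T [HT Hs]].
  set (b := Rmax t T).
  assert (Hb : t <= b /\ T <= b) by (split; [apply Rmax_l|apply Rmax_r]).
  assert (Hnz : forall s, t <= s -> dreduced Q P s <> 0).
  { intros s Hts H0. assert (HF := reduced_energy_nonneg Q P s HQ ltac:(lra)).
    rewrite H0 in HF.
    assert (Hq := profile_decreasing Q P t s HQ ltac:(lra)).
    assert (Hq0 := profile_pos Q P s HQ ltac:(lra)).
    assert (Q s ^ 2 <= Q t ^ 2) by (apply pow_incr; lra).
    assert (0 < reduced Q s ^ 2) by (apply pow_lt, (reduced_pos Q P); [exact HQ|lra]).
    nra. }
  assert (H0 := Hnz t (Rle_refl _)).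
  destruct (continuous_first_zero (dreduced Q P) t b) as [s [Hs1 [Hs2 _]]]; try lra.
  - intros z Hz. eapply is_derive_continuous, is_derive_dreduced; [exact HQ|lra].
  - apply Rlt_le, Hs. lra.
  - apply (Hnz s); [lra|exact Hs2]. }
split; [|exact Hneg].
assert (HF := reduced_energy_nonneg Q P t HQ Ht).
assert (Hu := reduced_pos Q P t HQ Ht).
assert (0 < reduced Q t ^ 2) by (apply pow_lt; lra).
assert ((r * reduced Q t) ^ 2 <= (- dreduced Q P t) ^ 2).
{ replace ((r * reduced Q t) ^ 2) with (reduced Q t ^ 2 * r ^ 2) by ring. nra. }
assert (0 <= r * reduced Q t) by nra.
assert (r * reduced Q t <= - dreduced Q P t); [|lra].
apply Rsqr_incr_0; [|lra|lra]. unfold Rsqr. nra.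
Qed.

(** * Quadratic barriers for [N] and estimates up to [t = 4/5] *)

Ltac slope_derive HQ Ht :=
  let H1 := fresh in let H2 := fresh in
  match type of HQ with profile ?Q ?P =>
    pose proof (is_derive_slope _ _ _ HQ Ht) as H1;
    pose proof (is_derive_excess _ _ _ HQ Ht) as H2;
    auto_derive;
    [ repeat split; try (eexists; eassumption); try lra
    | change (fun x : R => slope Q P x) with (slope Q P);
      change (fun x : R => excess Q x) with (excess Q);
      rewrite ?(is_derive_unique _ _ _ H1), ?(is_derive_unique _ _ _ H2);
      try (field; lra) ]
  end.

Ltac slope_continuous HQ Ht :=
  apply (ex_derive_continuous (V := R_NormedModule));
  let H1 := fresh in let H2 := fresh in
  pose proof (is_derive_slope _ _ _ HQ Ht) as H1;
  pose proof (is_derive_excess _ _ _ HQ Ht) as H2;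
  auto_derive; repeat split; try (eexists; eassumption); try lra.

(** For polynomials rewritten in the Bernstein basis of an interval: nonnegative coefficients times
    powers of the distances to the two endpoints. *)
Ltac bernstein_nonneg :=
  repeat apply Rplus_le_le_0_compat; repeat apply Rmult_le_pos;
  try apply pow_le; lra.

(** With [D = 3 x - 9/5 x^2 - N] one finds [t D' = (8/5 x - 1) D + x (2 t^2 - 18/25 x^2)]: the
    coefficients cancel the terms in [x] and [x^2]. The remainder is nonnegative exactly when
    [x <= 5 t / 3]. *)
Lemma excess_upper_barrier (Q P : R -> R) (b : R) :
  profile Q P -> 0 < b ->
  (forall t, 0 < t <= b -> slope Q P t <= 5 / 3 * t) ->
  excess Q b <= 3 * slope Q P b - 9 / 5 * slope Q P b ^ 2.
Proof.
intros HQ Hb Hx.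
destruct (slope_near_zero Q P HQ) as (d & Hd & Hnear).
assert (H : 0 <= 3 * slope Q P b - 9 / 5 * slope Q P b ^ 2 - excess Q b); [|lra].
apply (linear_comparison_from_zero
  (fun t => 3 * slope Q P t - 9 / 5 * slope Q P t ^ 2 - excess Q t)
  (fun t => ((3 - 18 / 5 * slope Q P t) * (slope Q P t ^ 2 - slope Q P t + excess Q t)
     - (2 * excess Q t - 2 * slope Q P t * (excess Q t + t ^ 2))) / t)
  (fun t => (8 / 5 * slope Q P t - 1) / t) b 1 d); try lra.
- intros t Ht. slope_continuous HQ Ht.
- intros t Ht. slope_derive HQ Ht.
- intros t Ht. assert (Hx0 := slope_pos Q P t HQ ltac:(lra)). assert (Hxt := Hx t Ht).
  apply Rmult_le_reg_r with t; [lra|].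
  assert (0 <= slope Q P t * (2 * t ^ 2 - 18 / 25 * slope Q P t ^ 2)).
  { apply Rmult_le_pos; [lra|]. nra. }
  field_simplify; try lra.
- intros t Ht. destruct (Hnear t ltac:(lra)) as [H1 H2].
  assert (Hx0 := slope_pos Q P t HQ ltac:(lra)). split.
  + apply Rmult_le_reg_r with t; [lra|]. field_simplify; lra.
  + nra.
Qed.

(** With [D = N - 3 x + 2 x^2] one finds [t D' = (2 x - 1) D + x (x - 2 t^2)], which explains the
    hypothesis on [x]. *)
Lemma excess_lower_barrier (Q P : R -> R) (b : R) :
  profile Q P -> 0 < b ->
  (forall t, 0 < t <= b -> 2 * t ^ 2 <= slope Q P t) ->
  3 * slope Q P b - 2 * slope Q P b ^ 2 <= excess Q b.
Proof.
intros HQ Hb Hx.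
destruct (slope_near_zero Q P HQ) as (d & Hd & Hnear).
assert (H : 0 <= excess Q b - 3 * slope Q P b + 2 * slope Q P b ^ 2); [|lra].
apply (linear_comparison_from_zero
  (fun t => excess Q t - 3 * slope Q P t + 2 * slope Q P t ^ 2)
  (fun t => (2 * excess Q t - 2 * slope Q P t * (excess Q t + t ^ 2)
     - (3 - 4 * slope Q P t) * (slope Q P t ^ 2 - slope Q P t + excess Q t)) / t)
  (fun t => (2 * slope Q P t - 1) / t) b 4 d); try lra.
- intros t Ht. slope_continuous HQ Ht.
- intros t Ht. slope_derive HQ Ht.
- intros t Ht. assert (Hx0 := slope_pos Q P t HQ ltac:(lra)). assert (Hxt := Hx t Ht).
  apply Rmult_le_reg_r with t; [lra|].
  assert (0 <= slope Q P t * (slope Q P t - 2 * t ^ 2)) by nra.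
  field_simplify; try lra.
- intros t Ht. destruct (Hnear t ltac:(lra)) as [H1 H2].
  assert (Hx0 := slope_pos Q P t HQ ltac:(lra)). split.
  + apply Rmult_le_reg_r with t; [lra|]. field_simplify; lra.
  + assert (- t <= excess Q t).
    { unfold excess. assert (0 <= t ^ 2 * Q t ^ 2) by (apply Rmult_le_pos; apply pow2_ge_0). nra. }
    assert (0 <= slope Q P t ^ 2) by apply pow2_ge_0. lra.
Qed.

(* The slope cannot stay below [5t/3] up to [3/2]: the upper barrier would make
   the reduced energy negative. At the first contact it grows at least as fast
   as [5t/3], which the upper barrier permits only before [t = 3/4]. *)
Lemma slope_first_contact (Q P : R -> R) :
  profile Q P -> exists s, 0 < s <= 3 / 4 /\ slope Q P s = 5 / 3 * s /\
  forall t, 0 < t <= s -> slope Q P t <= 5 / 3 * t.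
Proof.
intros HQ.
destruct (slope_near_zero Q P HQ) as (d & Hd & Hnear).
set (a := d / 2).
assert (Ha : 0 < a < d) by (unfold a; lra).
assert (Hsm : forall t, 0 < t <= a -> slope Q P t < 5 / 3 * t).
{ intros t Ht. destruct (Hnear t ltac:(lra)) as [H1 H2]. lra. }
destruct (classic (exists b, a <= b <= 3 / 2 /\ 5 / 3 * b <= slope Q P b)) as [[b [Hb Hxb]]|Hno].
- assert (Hda := Hsm a ltac:(lra)).
  destruct (continuous_first_zero (fun t => 5 / 3 * t - slope Q P t) a b) as [s [Hs [Hs0 Hsp]]]; try lra.
  { intros t Ht. assert (Ht0 : 0 < t) by lra. slope_continuous HQ Ht0. }
  assert (Hle : forall t, 0 < t <= s -> slope Q P t <= 5 / 3 * t).
  { intros t Ht. destruct (Rlt_le_dec t a) as [Hta|Hta].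
    - apply Rlt_le, Hsm. lra.
    - destruct (Rlt_le_dec t s) as [Hts|Hts].
      + assert (H := Hsp t ltac:(lra)). lra.
      + replace t with s by lra. lra. }
  exists s. repeat split; try lra; auto.
  assert (HB := excess_upper_barrier Q P s HQ ltac:(lra) Hle).
  (* At the contact [t x' >= x], while the barrier gives [t x' <= 2 x - 4/5 x^2]. Hence [x <= 5/4],
     that is [s <= 3/4]. *)
  assert (Hl : 5 / 3 - (slope Q P s ^ 2 - slope Q P s + excess Q s) / s <= 0).
  { apply (derive_nonpos_of_left_pos (fun t => 5 / 3 * t - slope Q P t) a s); auto; [lra|].
    assert (Hs1 : 0 < s) by lra. slope_derive HQ Hs1. }
  apply (Rmult_le_compat_r s) in Hl; [|lra].
  replace ((5 / 3 - (slope Q P s ^ 2 - slope Q P s + excess Q s) / s) * s)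
    with (5 / 3 * s - (slope Q P s ^ 2 - slope Q P s + excess Q s)) in Hl by (field; lra).
  assert (Hxs : slope Q P s = 5 / 3 * s) by lra. rewrite Hxs in *. nra.
- exfalso.
  assert (Hle : forall t, 0 < t <= 3 / 2 -> slope Q P t <= 5 / 3 * t).
  { intros t Ht. destruct (Rlt_le_dec t a) as [Hta|Hta].
    - apply Rlt_le, Hsm. lra.
    - apply Rnot_lt_le. intros Hlt. apply Hno. exists t. lra. }
  (* Barrier and energy together give [9/4 <= 2 - x + x^2 / 5], impossible for [0 < x < 5/2]. *)
  assert (HB := excess_upper_barrier Q P (3 / 2) HQ ltac:(lra) Hle).
  assert (HF := slope_energy Q P (3 / 2) HQ ltac:(lra)).
  assert (Hx1 := slope_lt Q P (3 / 2) HQ ltac:(lra)).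
  assert (Hx0 := slope_pos Q P (3 / 2) HQ ltac:(lra)). nra.
Qed.

(** Up to the contact time [s], the upper barrier yields [x >= 2 t^2], so the lower barrier becomes
    available and is continued beyond [s]. It gives [x >= lam t^2 (2 - x)], the inequality saying
    that [Q] decays at least as fast as [1 / (1 + lam t^2)]. The upper barrier bounds [Q s]. *)
Lemma reduced_at_four_fifths (Q P : R -> R) :
  profile Q P -> 32 / 25 <= slope Q P (4 / 5) /\ Q (4 / 5) ^ 2 <= 227 / 100.
Proof.
intros HQ.
destruct (slope_first_contact Q P HQ) as (s & Hs & Hxs & Hle).
assert (Hbelow : forall t, 0 < t <= s -> 2 * t ^ 2 <= slope Q P t).
{ intros t Ht.
  set (g := fun t => slope Q P t / ((2 - 4 / 5 * slope Q P t) * t ^ 2)).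
  assert (Hx2 : forall r, 0 < r <= s -> 1 <= 2 - 4 / 5 * slope Q P r).
  { intros r Hr. assert (H := Hle r Hr). lra. }
  assert (Hg : g s <= g t).
  { apply (nonincreasing_of_derive_nonpos g (fun t =>
      (2 * (slope Q P t ^ 2 - slope Q P t + excess Q t)
        - 2 * slope Q P t * (2 - 4 / 5 * slope Q P t))
      / ((2 - 4 / 5 * slope Q P t) ^ 2 * t ^ 3))); [lra| |].
    - intros r Hr. assert (Hr0 : 0 < r) by lra. unfold g.
      assert (H := Hx2 r ltac:(lra)).
      assert ((2 - 4 / 5 * slope Q P r) * (r * (r * 1)) <> 0)
        by (apply Rgt_not_eq, Rmult_lt_0_compat; nra).
      slope_derive HQ Hr0.
    - intros r Hr.
      assert (HB := excess_upper_barrier Q P r HQ ltac:(lra) (fun z Hz => Hle z ltac:(lra))).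
      assert (H := Hx2 r ltac:(lra)).
      assert (Hp : 0 < (2 - 4 / 5 * slope Q P r) ^ 2 * r ^ 3)
        by (apply Rmult_lt_0_compat; apply pow_lt; lra).
      apply (proj2 (Rle_div_l _ _ _ Hp)). rewrite Rmult_0_l. nra. }
  (* [g s = 5 / (s (6 - 4 s))], and the denominator is at most [9/4], its value at [s = 3/4]. *)
  assert (Hk : 20 / 9 <= g s).
  { unfold g. rewrite Hxs.
    assert (Hp : 0 < (2 - 4 / 5 * (5 / 3 * s)) * s ^ 2)
      by (apply Rmult_lt_0_compat; [lra|apply pow_lt; lra]).
    apply (proj1 (Rle_div_r _ _ _ Hp)).
    assert (0 <= s * ((s - 3 / 4) ^ 2)) by (apply Rmult_le_pos; [lra|apply pow2_ge_0]). nra. }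
  assert (H := Hx2 t Ht).
  assert (Ht2 : 0 < t ^ 2) by (apply pow_lt; lra).
  assert (Hgt : slope Q P t = g t * ((2 - 4 / 5 * slope Q P t) * t ^ 2)).
  { unfold g. field. lra. }
  assert (2 * t ^ 2 <= g t * ((2 - 4 / 5 * slope Q P t) * t ^ 2)); [|lra].
  assert (1 * t ^ 2 <= (2 - 4 / 5 * slope Q P t) * t ^ 2) by (apply Rmult_le_compat_r; lra).
  apply Rmult_le_compat; lra. }
(* [lam] is the value at [s] of [x / ((2 - x) t^2)], which the lower barrier makes nondecreasing. *)
set (lam := 5 / (s * (6 - 5 * s))).
assert (Hden : 0 < s * (6 - 5 * s) <= 9 / 5).
{ assert (H := pow2_ge_0 (s - 3 / 5)). split; nra. }
assert (Hlam : 25 / 9 <= lam).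
{ unfold lam. apply (proj1 (Rle_div_r _ _ _ (proj1 Hden))). lra. }
assert (Hgrow : forall b, s <= b <= 4 / 5 ->
   (forall t, s <= t <= b -> 2 * t ^ 2 <= slope Q P t) ->
   lam * b ^ 2 * (2 - slope Q P b) <= slope Q P b).
{ intros b Hb Hge.
  set (g := fun t => slope Q P t / ((2 - slope Q P t) * t ^ 2)).
  assert (Hx2 : forall r, 0 < r <= b -> 0 < 2 - slope Q P r).
  { intros r Hr. assert (H := slope_lt Q P r HQ ltac:(lra)). lra. }
  assert (Hg : g s <= g b).
  { apply (nondecreasing_of_derive_nonneg g (fun t =>
      (2 * (slope Q P t ^ 2 - slope Q P t + excess Q t)
        - 2 * slope Q P t * (2 - slope Q P t))
      / ((2 - slope Q P t) ^ 2 * t ^ 3))); [lra| |].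
    - intros r Hr. assert (Hr0 : 0 < r) by lra. unfold g.
      assert (H := Hx2 r ltac:(lra)).
      assert ((2 - slope Q P r) * (r * (r * 1)) <> 0)
        by (apply Rgt_not_eq, Rmult_lt_0_compat; nra).
      slope_derive HQ Hr0.
    - intros r Hr.
      assert (HB : 3 * slope Q P r - 2 * slope Q P r ^ 2 <= excess Q r).
      { apply excess_lower_barrier; [exact HQ|lra|]. intros z Hz.
        destruct (Rle_lt_dec z s); [apply Hbelow; lra|apply Hge; lra]. }
      assert (H := Hx2 r ltac:(lra)).
      apply Rdiv_le_0_compat; [nra|].
      apply Rmult_lt_0_compat; apply pow_lt; lra. }
  assert (Hgs : g s = lam).
  { unfold g, lam. rewrite Hxs. field. lra. }
  assert (H := Hx2 b ltac:(lra)).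
  assert (Hb2 : 0 < b ^ 2) by (apply pow_lt; lra).
  assert (Hgb : slope Q P b = g b * ((2 - slope Q P b) * b ^ 2)).
  { unfold g. field. lra. }
  rewrite Hgs in Hg.
  apply Rle_trans with (g b * ((2 - slope Q P b) * b ^ 2)); [|lra].
  replace (lam * b ^ 2 * (2 - slope Q P b)) with (lam * ((2 - slope Q P b) * b ^ 2)) by ring.
  apply Rmult_le_compat_r; nra. }
(* Continuation: if [x = 2 r^2] at a first time [r], then [lam (1 - r^2) <= 1], and [lam >= 25/9]
   forces [r >= 4/5]. *)
assert (Hge : forall t, s <= t <= 4 / 5 -> 2 * t ^ 2 <= slope Q P t).
{ intros t Ht. apply Rnot_lt_le. intros Hlt.
  destruct (continuous_first_zero (fun t => slope Q P t - 2 * t ^ 2) s t) as [r [Hr [Hr0 Hrp]]]; try lra.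
  { intros z Hz. assert (Hz0 : 0 < z) by lra. slope_continuous HQ Hz0. }
  { rewrite Hxs. nra. }
  assert (Hgr := Hgrow r ltac:(lra)).
  assert (Hall : forall z, s <= z <= r -> 2 * z ^ 2 <= slope Q P z).
  { intros z Hz. destruct (Rlt_le_dec z r) as [Hzr|Hzr].
    - assert (H := Hrp z ltac:(lra)). lra.
    - replace z with r by lra. lra. }
  specialize (Hgr Hall).
  assert (Hxr : slope Q P r = 2 * r ^ 2) by lra. rewrite Hxr in Hgr.
  assert (Hr2 : 0 < r ^ 2) by (apply pow_lt; lra).
  assert (H1 : lam * (1 - r ^ 2) <= 1) by nra.
  assert (H2 : 16 / 25 <= r ^ 2).
  { apply Rnot_lt_le. intros H3. nra. }
  assert (4 / 5 <= r) by nra.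
  assert (r = t) by lra. subst r. lra. }
assert (Hfin := Hgrow (4 / 5) ltac:(lra) Hge).
assert (Hxl := slope_lt Q P (4 / 5) HQ ltac:(lra)).
split; [nra|].
assert (Hq : Q (4 / 5) * (1 + lam * (4 / 5) ^ 2) <= Q s * (1 + lam * s ^ 2)).
{ apply (nonincreasing_of_derive_nonpos (fun t => Q t * (1 + lam * t ^ 2))
    (fun t => P t * (1 + lam * t ^ 2) + Q t * (lam * (2 * t)))); [lra| |].
  - intros r Hr. assert (Hr0 : 0 < r) by lra. prof_derive HQ Hr0.
  - intros r Hr.
    assert (Hgr := Hgrow r ltac:(lra) (fun z Hz => Hge z ltac:(lra))).
    assert (Hq0 := profile_pos Q P r HQ ltac:(lra)).
    assert (HP : P r = - (slope Q P r * Q r / r)) by (unfold slope; field; lra).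
    apply Rmult_le_reg_r with (r / Q r); [apply Rdiv_lt_0_compat; lra|].
    rewrite HP.
    replace ((- (slope Q P r * Q r / r) * (1 + lam * r ^ 2) + Q r * (lam * (2 * r))) * (r / Q r))
      with (2 * lam * r ^ 2 - slope Q P r * (1 + lam * r ^ 2)) by (field; lra).
    nra. }
assert (Hqs : s ^ 2 * Q s ^ 2 <= 5 * s - 4 * s ^ 2).
{ assert (HB := excess_upper_barrier Q P s HQ ltac:(lra) Hle). rewrite Hxs in HB.
  unfold excess in HB. nra. }
assert (Hq0 := profile_pos Q P (4 / 5) HQ ltac:(lra)).
assert (Hqs0 := profile_pos Q P s HQ ltac:(lra)).
(* This eliminates [lam], leaving a polynomial inequality in [s] alone on [(0, 3/4]]. *)
assert (He : (1 + lam * s ^ 2) * (16 / 5 + 6 * s - 5 * s ^ 2) = 6 * s * (1 + lam * (4 / 5) ^ 2)).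
{ unfold lam. field. lra. }
set (W := 16 / 5 + 6 * s - 5 * s ^ 2) in *.
assert (HW : 0 < W) by (unfold W; nra).
assert (Hl1 : 0 < 1 + lam * (4 / 5) ^ 2) by nra.
assert (Hq1 : Q (4 / 5) * W <= 6 * (s * Q s)).
{ apply Rmult_le_reg_r with (1 + lam * (4 / 5) ^ 2); [exact Hl1|].
  replace (6 * (s * Q s) * (1 + lam * (4 / 5) ^ 2)) with (Q s * ((1 + lam * s ^ 2) * W)) by (rewrite He; ring).
  nra. }
assert (Hq2 : Q (4 / 5) ^ 2 * W ^ 2 <= 36 * (5 * s - 4 * s ^ 2)).
{ apply Rle_trans with ((6 * (s * Q s)) ^ 2).
  - rewrite <- Rpow_mult_distr. apply pow_incr. split; [nra|exact Hq1].
  - nra. }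
assert (Hq3 : 36 * (5 * s - 4 * s ^ 2) <= 227 / 100 * W ^ 2).
{ unfold W.
  assert (0 <= 227 / 100 * (16 / 5 + 6 * s - 5 * s ^ 2) ^ 2 - 36 * (5 * s - 4 * s ^ 2)); [|lra].
  destruct (Rle_lt_dec s (1 / 2)) as [Hc|Hc].
  - replace (227 / 100 * (16 / 5 + 6 * s - 5 * s ^ 2) ^ 2 - 36 * (5 * s - 4 * s ^ 2)) with
    (232448 / 625 * ((1 / 2 - s) ^ 4) +
     465632 / 625 * (s ^ 1) * ((1 / 2 - s) ^ 3) +
     384908 / 625 * (s ^ 2) * ((1 / 2 - s) ^ 2) +
     132462 / 625 * (s ^ 3) * ((1 / 2 - s) ^ 1) +
     64827 / 2500 * (s ^ 4)) by field.
    bernstein_nonneg.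
  - replace (227 / 100 * (16 / 5 + 6 * s - 5 * s ^ 2) ^ 2 - 36 * (5 * s - 4 * s ^ 2)) with
    (259308 / 625 * ((3 / 4 - s) ^ 4) +
     496152 / 625 * ((s - 1 / 2) ^ 1) * ((3 / 4 - s) ^ 3) +
     271658 / 625 * ((s - 1 / 2) ^ 2) * ((3 / 4 - s) ^ 2) +
     35342 / 625 * ((s - 1 / 2) ^ 3) * ((3 / 4 - s) ^ 1) +
     143987 / 2500 * ((s - 1 / 2) ^ 4)) by field.
    bernstein_nonneg. }
apply Rmult_le_reg_r with (W ^ 2); [apply pow_lt; exact HW|]. lra.
Qed.

(** * Decay of [u] from [t = 4/5] onwards, and the bound for [t >= 3/2] *)

(** As [Q] decreases, the rate [r] admissible at [a] remains so on the whole interval. Thus [u]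
    decreases and [u' <= - r u <= - r u(b)], which is integrated linearly. *)
Lemma reduced_decay (Q P : R -> R) (a b r : R) :
  profile Q P -> 0 < a <= b -> Q a ^ 2 < 2 -> 0 <= r -> r ^ 2 <= 1 - Q a ^ 2 / 2 ->
  reduced Q b * (1 + r * (b - a)) <= reduced Q a.
Proof.
intros HQ Hab Ha Hr Hr2.
assert (Hd : forall s, a <= s <= b -> dreduced Q P s <= - (r * reduced Q s) /\ dreduced Q P s < 0).
{ intros s Hs. assert (Hq := profile_decreasing Q P a s HQ ltac:(lra)).
  assert (Hq0 := profile_pos Q P s HQ ltac:(lra)).
  assert (Q s ^ 2 <= Q a ^ 2) by (apply pow_incr; lra).
  apply dreduced_upper_bound; try lra; exact HQ. }
assert (H : reduced Q b + r * reduced Q b * b <= reduced Q a + r * reduced Q b * a); [|lra].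
apply (nonincreasing_of_derive_nonpos (fun t => reduced Q t + r * reduced Q b * t)
  (fun t => dreduced Q P t + r * reduced Q b)); [lra| |].
- intros s Hs. apply (is_derive_plus (reduced Q) (fun t => r * reduced Q b * t)).
  + apply is_derive_reduced; [exact HQ|lra].
  + auto_derive; [easy|ring].
- intros s Hs. destruct (Hd s Hs) as [H1 _].
  assert (reduced Q b <= reduced Q s).
  { apply (nonincreasing_of_derive_nonpos (reduced Q) (dreduced Q P)); [lra| |].
    - intros z Hz. apply is_derive_reduced; [exact HQ|lra].
    - intros z Hz. apply Rlt_le, Hd. lra. }
  nra.
Qed.

(** If [Q 1 > 1], then [N >= 0] on [[4/5, 1]], and [x] cannot descend to [127/100], where
    [t x' >= x^2 - x > 0]. Hence [u' <= - 27/100 u] there. *)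
Lemma reduced_at_one (Q P : R -> R) : profile Q P -> reduced Q 1 <= 143 / 125.
Proof.
intros HQ. destruct (reduced_at_four_fifths Q P HQ) as [Hx Hq].
destruct (Rle_lt_dec (Q 1) 1) as [H1|H1]; [unfold reduced; lra|].
assert (Hslope : forall t, 4 / 5 <= t <= 1 -> 127 / 100 <= slope Q P t).
{ intros t Ht. apply Rnot_lt_le. intros Hlt.
  destruct (continuous_first_zero (fun t => slope Q P t - 127 / 100) (4 / 5) t)
    as [s [Hs [Hs0 Hsp]]]; try lra.
  { intros z Hz. assert (Hz0 : 0 < z) by lra. slope_continuous HQ Hz0. }
  assert (Hs1 : 0 < s) by lra.
  assert (Hl : (slope Q P s ^ 2 - slope Q P s + excess Q s) / s <= 0).
  { apply (derive_nonpos_of_left_pos (fun t => slope Q P t - 127 / 100) (4 / 5) s); auto; [lra|].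
    slope_derive HQ Hs1. }
  assert (Hex : 0 <= excess Q s).
  { assert (Hqs := profile_decreasing Q P s 1 HQ ltac:(lra)). unfold excess.
    apply Rmult_le_pos; [apply pow2_ge_0|nra]. }
  apply (proj1 (Rle_div_l _ _ _ Hs1)) in Hl.
  replace (slope Q P s) with (127 / 100) in Hl by lra. lra. }
assert (Hu : reduced Q 1 + 27 / 100 * reduced Q 1 * 1
          <= reduced Q (4 / 5) + 27 / 100 * reduced Q 1 * (4 / 5)).
{ assert (Hd : forall s, 4 / 5 <= s <= 1 -> dreduced Q P s <= - (27 / 100 * reduced Q s)).
  { intros s Hs. assert (Hds := dreduced_slope Q P s HQ ltac:(lra)).
    assert (Hus := reduced_pos Q P s HQ ltac:(lra)). assert (Hxs := Hslope s Hs). nra. }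
  apply (nonincreasing_of_derive_nonpos (fun t => reduced Q t + 27 / 100 * reduced Q 1 * t)
    (fun t => dreduced Q P t + 27 / 100 * reduced Q 1)); [lra| |].
  - intros s Hs. apply (is_derive_plus (reduced Q) (fun t => 27 / 100 * reduced Q 1 * t)).
    + apply is_derive_reduced; [exact HQ|lra].
    + auto_derive; [easy|ring].
  - intros s Hs.
    assert (reduced Q 1 <= reduced Q s).
    { apply (nonincreasing_of_derive_nonpos (reduced Q) (dreduced Q P)); [lra| |].
      - intros z Hz. apply is_derive_reduced; [exact HQ|lra].
      - intros z Hz. assert (Hdz := Hd z ltac:(lra)).
        assert (Huz := reduced_pos Q P z HQ ltac:(lra)). lra. }
    assert (Hds := Hd s Hs). lra. }
assert (Hq0 := profile_pos Q P (4 / 5) HQ ltac:(lra)).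
assert (Q (4 / 5) <= 15067 / 10000) by nra.
unfold reduced in *. lra.
Qed.

(** Each rate lies just below [sqrt (1 - Q^2 / 2)] for the current bound on [Q]. The steps end with
    [u (3/2) <= 0.812 < sqrt (2/3)], and rate [0] carries this to all later [t]. *)
Lemma reduced_bound_large (Q P : R -> R) (t : R) :
  profile Q P -> 3 / 2 <= t -> 3 * reduced Q t ^ 2 <= 2.
Proof.
intros HQ Ht.
assert (H0 := reduced_at_one Q P HQ).
assert (Hp1 := profile_pos Q P 1 HQ ltac:(lra)).
assert (Hp2 := profile_pos Q P (11 / 10) HQ ltac:(lra)).
assert (Hp3 := profile_pos Q P (5 / 4) HQ ltac:(lra)).
assert (Hp4 := profile_pos Q P (3 / 2) HQ ltac:(lra)).
unfold reduced in H0.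
assert (Hq1 : Q 1 ^ 2 <= (143 / 125) ^ 2) by (apply pow_incr; lra).
assert (H1 := reduced_decay Q P 1 (11 / 10) (587 / 1000) HQ ltac:(lra) ltac:(lra) ltac:(lra) ltac:(lra)).
unfold reduced in H1.
assert (Hq2 : Q (11 / 10) ^ 2 <= (983 / 1000) ^ 2) by (apply pow_incr; lra).
assert (H2 := reduced_decay Q P (11 / 10) (5 / 4) (718 / 1000) HQ ltac:(lra) ltac:(lra) ltac:(lra) ltac:(lra)).
unfold reduced in H2.
assert (Hq3 : Q (5 / 4) ^ 2 <= (781 / 1000) ^ 2) by (apply pow_incr; lra).
assert (H3 := reduced_decay Q P (5 / 4) (3 / 2) (833 / 1000) HQ ltac:(lra) ltac:(lra) ltac:(lra) ltac:(lra)).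
unfold reduced in H3.
assert (Hq4 : Q (3 / 2) ^ 2 <= (541 / 1000) ^ 2) by (apply pow_incr; lra).
assert (H4 := reduced_decay Q P (3 / 2) t 0 HQ ltac:(lra) ltac:(lra) ltac:(lra) ltac:(lra)).
assert (Hpt := reduced_pos Q P t HQ ltac:(lra)).
unfold reduced in H4 at 2.
assert (reduced Q t ^ 2 <= (812 / 1000) ^ 2) by (apply pow_incr; lra).
lra.
Qed.

(** * The bound for [t <= 1/5] *)

(** The coefficients [1/3], [1/15], [2/45] cancel every term of degree at most 2 in [N] and [t^2].
    What remains has only positive coefficients, so it is nonnegative when [N >= 0]. *)
Lemma slope_lower_bound (Q P : R -> R) (b : R) :
  profile Q P -> 0 < b -> (forall t, 0 < t <= b -> 0 <= excess Q t) ->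
  excess Q b / 3 + excess Q b ^ 2 / 15 + 2 / 45 * excess Q b * b ^ 2 <= slope Q P b.
Proof.
intros HQ Hb HN.
destruct (slope_near_zero Q P HQ) as (d & Hd & Hnear).
set (xi := fun t => excess Q t / 3 + excess Q t ^ 2 / 15 + 2 / 45 * excess Q t * t ^ 2).
assert (H : 0 <= slope Q P b - xi b); [|unfold xi in H; lra].
assert (Hd' : 0 < Rmin d b) by (apply Rmin_glb_lt; lra).
apply (linear_comparison_from_zero (fun t => slope Q P t - xi t)
  (fun t => (slope Q P t ^ 2 - slope Q P t + excess Q t
     - (1 / 3 + 2 / 15 * excess Q t + 2 / 45 * t ^ 2)
       * (2 * excess Q t - 2 * slope Q P t * (excess Q t + t ^ 2))
     - 4 / 45 * excess Q t * t ^ 2) / t)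
  (fun t => (slope Q P t + xi t - 1
     + 2 * (1 / 3 + 2 / 15 * excess Q t + 2 / 45 * t ^ 2) * (excess Q t + t ^ 2)) / t)
  b 1 (Rmin d b)); try lra.
- intros t Ht. unfold xi. slope_continuous HQ Ht.
- intros t Ht. unfold xi. slope_derive HQ Ht.
- intros t Ht. assert (HNt := HN t Ht).
  assert (Ht2 : 0 <= t ^ 2) by apply pow2_ge_0.
  apply Rmult_le_reg_r with t; [lra|].
  assert (Hpos : forall N m, 0 <= N -> 0 <= m -> 0 <= 8 / 45 * N ^ 3 + 2 / 9 * N ^ 2 * m + 1 / 45 * N ^ 4 + 28 / 675 * N ^ 3 * m
     + 16 / 675 * N ^ 2 * m ^ 2 + 8 / 135 * N * m ^ 2 + 8 / 2025 * N * m ^ 3).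
  { intros N m HN0 Hm0. bernstein_nonneg. }
  specialize (Hpos _ _ HNt Ht2). unfold xi. field_simplify; [|lra|lra].
  field_simplify in Hpos. lra.
- intros t Ht.
  assert (Htd : t < d /\ t < b) by (revert Ht; unfold Rmin; destruct (Rle_dec _ _); lra).
  destruct (Hnear t ltac:(lra)) as [H1 H2].
  assert (Hx0 := slope_pos Q P t HQ ltac:(lra)). assert (HNt := HN t ltac:(lra)).
  assert (Ht2 : 0 <= t ^ 2 <= 1 / 100) by nra.
  assert (HN2 : 0 <= excess Q t ^ 2 <= excess Q t) by nra.
  assert (HNm : 0 <= excess Q t * t ^ 2 <= excess Q t) by nra.
  split; [|unfold xi; nra].
  apply Rmult_le_reg_r with t; [lra|]. unfold xi.
  replace ((slope Q P t + (excess Q t / 3 + excess Q t ^ 2 / 15 + 2 / 45 * excess Q t * t ^ 2) - 1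
     + 2 * (1 / 3 + 2 / 15 * excess Q t + 2 / 45 * t ^ 2) * (excess Q t + t ^ 2)) / t * t)
  with (slope Q P t + (excess Q t / 3 + excess Q t ^ 2 / 15 + 2 / 45 * excess Q t * t ^ 2) - 1
     + 2 * (1 / 3 + 2 / 15 * excess Q t + 2 / 45 * t ^ 2) * (excess Q t + t ^ 2)) by (field; lra).
  nra.
Qed.

(** Here [m] stands for [t^2]. The terms of degree at most 2 invert the expansion of [x] in
    [slope_lower_bound]. *)
Definition quartic (x m : R) : R :=
  3 * x - 9 / 5 * x ^ 2 - 2 / 5 * x * m + x ^ 3 / 50 + 9 / 100 * x ^ 4.

(* The rate at which the flow moves away from the surface [N = quartic x m],
   divided by [x]. *)
Definition quartic_defect (x m : R) : R :=
  29 / 50 * x ^ 2 - 73 / 100 * x ^ 3 + 1077 / 2500 * x ^ 4 - 63 / 5000 * x ^ 5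
  - 81 / 2500 * x ^ 6 - m * x * (24 / 25 - 4 / 125 * x - 9 / 50 * x ^ 2) - 4 / 25 * m ^ 2.

Lemma excess_quartic_barrier (Q P : R -> R) (b : R) :
  profile Q P -> 0 < b ->
  (forall t, 0 < t <= b -> 0 <= quartic_defect (slope Q P t) (t ^ 2)) ->
  quartic (slope Q P b) (b ^ 2) <= excess Q b.
Proof.
intros HQ Hb HR.
destruct (slope_near_zero Q P HQ) as (d & Hd & Hnear).
assert (H : 0 <= excess Q b - quartic (slope Q P b) (b ^ 2)); [|lra].
apply (linear_comparison_from_zero
  (fun t => excess Q t - quartic (slope Q P t) (t ^ 2))
  (fun t => (2 * excess Q t - 2 * slope Q P t * (excess Q t + t ^ 2)
     - (3 - 18 / 5 * slope Q P t - 2 / 5 * t ^ 2 + 3 / 50 * slope Q P t ^ 2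
        + 9 / 25 * slope Q P t ^ 3) * (slope Q P t ^ 2 - slope Q P t + excess Q t)
     + 4 / 5 * slope Q P t * t ^ 2) / t)
  (fun t => (8 / 5 * slope Q P t - 1 + 2 / 5 * t ^ 2 - 3 / 50 * slope Q P t ^ 2
     - 9 / 25 * slope Q P t ^ 3) / t) b 4 d); try lra.
- intros t Ht. slope_continuous HQ Ht.
- intros t Ht. unfold quartic. slope_derive HQ Ht.
- intros t Ht. assert (Hx0 := slope_pos Q P t HQ ltac:(lra)). assert (HRt := HR t Ht).
  apply Rmult_le_reg_r with t; [lra|].
  assert (HR0 : 0 <= slope Q P t * quartic_defect (slope Q P t) (t ^ 2)) by (apply Rmult_le_pos; lra).
  unfold quartic_defect in HR0. unfold quartic. field_simplify; [|lra|lra].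
  field_simplify in HR0. lra.
- intros t Ht. destruct (Hnear t Ht) as [H1 H2].
  assert (Hx0 := slope_pos Q P t HQ ltac:(lra)).
  assert (Hx2 : 0 < slope Q P t ^ 2 <= slope Q P t) by nra.
  assert (Hx3 : 0 < slope Q P t ^ 3 <= slope Q P t) by (simpl; nra).
  assert (Hx4 : 0 < slope Q P t ^ 4 <= slope Q P t) by (simpl in *; nra).
  assert (Ht2 : 0 <= t ^ 2 <= t / 10) by nra. split.
  + apply (proj2 (Rle_div_l _ _ _ (proj1 Ht))). rewrite Rmult_0_l. lra.
  + assert (- t <= excess Q t).
    { unfold excess. assert (0 <= t ^ 2 * Q t ^ 2) by (apply Rmult_le_pos; apply pow2_ge_0). nra. }
    assert (0 <= slope Q P t * t ^ 2) by nra.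
    unfold quartic. lra.
Qed.

(* A cubic lying just below [x / t^2] along the trajectory with [t Q t = sqrt (2/3)]
   at [t = 1/5], the slowest one to be excluded. *)
Definition level (x : R) : R := 657 / 100 - 581 / 200 * x + 23 / 200 * x ^ 3.

(** The range reflects [x < 1 + t] from [slope_lt], for [t <= 11/10]. *)
Lemma level_pos (x : R) : 0 <= x <= 21 / 10 -> 0 < level x.
Proof.
intros Hx. unfold level.
assert (0 <= x * (21 / 10 - x) ^ 2) by (apply Rmult_le_pos; [lra|apply pow2_ge_0]).
assert (0 <= (21 / 10 - x) ^ 2) by apply pow2_ge_0.
nra.
Qed.

(** The inequality of [level_first_contact] after substituting [m = x / level x] and clearing
    [x^2 / level x ^ 2]. The margin [1/200] gives strictness. *)
Lemma level_flow_pos (x : R) :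
  0 <= x <= 21 / 10 ->
  0 < (581 / 200 - 69 / 200 * x ^ 2)
     * ((2 - 4 / 5 * x + x ^ 2 / 50 + 9 / 100 * x ^ 3) * level x - 2 / 5 * x)
   - (level x ^ 2 * (4 / 5 - x / 50 - 9 / 100 * x ^ 2) + 2 / 5 * level x).
Proof.
intros Hx.
assert (H : 0 <= (581 / 200 - 69 / 200 * x ^ 2)
     * ((2 - 4 / 5 * x + x ^ 2 / 50 + 9 / 100 * x ^ 3) * level x - 2 / 5 * x)
   - (level x ^ 2 * (4 / 5 - x / 50 - 9 / 100 * x ^ 2) + 2 / 5 * level x) - 1 / 200); [|lra].
replace ((581 / 200 - 69 / 200 * x ^ 2)
     * ((2 - 4 / 5 * x + x ^ 2 / 50 + 9 / 100 * x ^ 3) * level x - 2 / 5 * x)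
   - (level x ^ 2 * (4 / 5 - x / 50 - 9 / 100 * x ^ 2) + 2 / 5 * level x) - 1 / 200)
  with (100678000 / 37822859361 * ((21 / 10 - x) ^ 8) +
     648748880 / 37822859361 * (x ^ 1) * ((21 / 10 - x) ^ 7) +
     181135792 / 5403265623 * (x ^ 2) * ((21 / 10 - x) ^ 6) +
     3289217761 / 108065312460 * (x ^ 3) * ((21 / 10 - x) ^ 5) +
     4738199488 / 135081640575 * (x ^ 4) * ((21 / 10 - x) ^ 4) +
     439449984121 / 10806531246000 * (x ^ 5) * ((21 / 10 - x) ^ 3) +
     1854339979091 / 108065312460000 * (x ^ 6) * ((21 / 10 - x) ^ 2) +
     9682284252131 / 3782285936100000 * (x ^ 7) * ((21 / 10 - x) ^ 1) +
     984346528199 / 75645718722000000 * (x ^ 8)) by (unfold level; field).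
bernstein_nonneg.
Qed.

(** This is [quartic_defect x (x / v)] times [v^2 / x^2], for [v = level x]. *)
Lemma level_defect_nonneg (x : R) :
  0 <= x <= 21 / 10 ->
  0 <= (29 / 50 - 73 / 100 * x + 1077 / 2500 * x ^ 2 - 63 / 5000 * x ^ 3 - 81 / 2500 * x ^ 4) * level x ^ 2
     - (24 / 25 - 4 / 125 * x - 9 / 50 * x ^ 2) * level x - 4 / 25.
Proof.
intros Hx. destruct (Rle_lt_dec x 1) as [Hc|Hc].
- replace ((29 / 50 - 73 / 100 * x + 1077 / 2500 * x ^ 2 - 63 / 5000 * x ^ 3 - 81 / 2500 * x ^ 4) * level x ^ 2
     - (24 / 25 - 4 / 125 * x - 9 / 50 * x ^ 2) * level x - 4 / 25)
    with (9284221 / 500000 * ((1 - x) ^ 10) +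
     135033497 / 1000000 * (x ^ 1) * ((1 - x) ^ 9) +
     21608331871 / 50000000 * (x ^ 2) * ((1 - x) ^ 8) +
     80143465101 / 100000000 * (x ^ 3) * ((1 - x) ^ 7) +
     47702431997 / 50000000 * (x ^ 4) * ((1 - x) ^ 6) +
     152562497739 / 200000000 * (x ^ 5) * ((1 - x) ^ 5) +
     83231235907 / 200000000 * (x ^ 6) * ((1 - x) ^ 4) +
     962128981 / 6250000 * (x ^ 7) * ((1 - x) ^ 3) +
     934882309 / 25000000 * (x ^ 8) * ((1 - x) ^ 2) +
     13740277 / 2500000 * (x ^ 9) * ((1 - x) ^ 1) +
     4772059 / 12500000 * (x ^ 10)) by (unfold level; field).
  bernstein_nonneg.
- replace ((29 / 50 - 73 / 100 * x + 1077 / 2500 * x ^ 2 - 63 / 5000 * x ^ 3 - 81 / 2500 * x ^ 4) * level x ^ 2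
     - (24 / 25 - 4 / 125 * x - 9 / 50 * x ^ 2) * level x - 4 / 25)
    with (3817647200 / 25937424601 * ((21 / 10 - x) ^ 10) +
     19713372400 / 25937424601 * ((x - 1) ^ 1) * ((21 / 10 - x) ^ 9) +
     67453689076 / 25937424601 * ((x - 1) ^ 2) * ((21 / 10 - x) ^ 8) +
     986023913096 / 129687123005 * ((x - 1) ^ 3) * ((21 / 10 - x) ^ 7) +
     81304033140019 / 5187484920200 * ((x - 1) ^ 4) * ((21 / 10 - x) ^ 6) +
     1081085630295921 / 51874849202000 * ((x - 1) ^ 5) * ((21 / 10 - x) ^ 5) +
     1157132004318841 / 64843561502500 * ((x - 1) ^ 6) * ((21 / 10 - x) ^ 4) +
     12799297626987753 / 1296871230050000 * ((x - 1) ^ 7) * ((21 / 10 - x) ^ 3) +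
     35636733455382857 / 10374969840400000 * ((x - 1) ^ 8) * ((21 / 10 - x) ^ 2) +
     357822496708312963 / 518748492020000000 * ((x - 1) ^ 9) * ((21 / 10 - x) ^ 1) +
     39769906829384579 / 648435615025000000 * ((x - 1) ^ 10)) by (unfold level; field).
  bernstein_nonneg.
Qed.

Lemma initial_defect_nonneg (x : R) :
  0 <= x <= 6 / 5 ->
  0 <= (29 / 50 - 73 / 100 * x + 1077 / 2500 * x ^ 2 - 63 / 5000 * x ^ 3 - 81 / 2500 * x ^ 4) * (26 / 5) ^ 2
     - (24 / 25 - 4 / 125 * x - 9 / 50 * x ^ 2) * (26 / 5) - 4 / 25.
Proof.
intros Hx.
replace ((29 / 50 - 73 / 100 * x + 1077 / 2500 * x ^ 2 - 63 / 5000 * x ^ 3 - 81 / 2500 * x ^ 4) * (26 / 5) ^ 2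
     - (24 / 25 - 4 / 125 * x - 9 / 50 * x ^ 2) * (26 / 5) - 4 / 25)
  with (1097 / 216 * ((6 / 5 - x) ^ 4) +
     9707 / 1080 * (x ^ 1) * ((6 / 5 - x) ^ 3) +
     78467 / 15000 * (x ^ 2) * ((6 / 5 - x) ^ 2) +
     2382259 / 675000 * (x ^ 3) * ((6 / 5 - x) ^ 1) +
     2246573 / 1687500 * (x ^ 4)) by (unfold level; field).
bernstein_nonneg.
Qed.

(** On this range the defect decreases with [m], so the worst case is [m = x / v]; there it is
    [x^2 / v^2] times the last hypothesis. *)
Lemma quartic_defect_nonneg (x m v : R) :
  0 <= x <= 21 / 10 -> 0 <= m -> 0 < v -> m * v <= x ->
  0 <= (29 / 50 - 73 / 100 * x + 1077 / 2500 * x ^ 2 - 63 / 5000 * x ^ 3 - 81 / 2500 * x ^ 4) * v ^ 2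
     - (24 / 25 - 4 / 125 * x - 9 / 50 * x ^ 2) * v - 4 / 25 ->
  0 <= quartic_defect x m.
Proof.
intros Hx Hm Hv Hmv H.
assert (HL : 0 <= 24 / 25 - 4 / 125 * x - 9 / 50 * x ^ 2) by nra.
apply Rmult_le_reg_l with (v ^ 2); [apply pow_lt; exact Hv|]. rewrite Rmult_0_r.
assert (Hmv0 : 0 <= m * v) by nra.
assert (Hx2 : 0 <= x ^ 2) by apply pow2_ge_0.
assert (H1 : 0 <= x * (x - m * v)) by nra.
assert (H2 : 0 <= (x * (x - m * v)) * ((24 / 25 - 4 / 125 * x - 9 / 50 * x ^ 2) * v))
  by (apply Rmult_le_pos; [exact H1|apply Rmult_le_pos; lra]).
assert (H3 : 0 <= x ^ 2 - (m * v) ^ 2) by nra.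
assert (H4 := Rmult_le_pos _ _ Hx2 H).
replace (v ^ 2 * quartic_defect x m) with
  (x ^ 2 * ((29 / 50 - 73 / 100 * x + 1077 / 2500 * x ^ 2 - 63 / 5000 * x ^ 3 - 81 / 2500 * x ^ 4) * v ^ 2
     - (24 / 25 - 4 / 125 * x - 9 / 50 * x ^ 2) * v - 4 / 25)
   + (x * (x - m * v)) * ((24 / 25 - 4 / 125 * x - 9 / 50 * x ^ 2) * v)
   + 4 / 25 * (x ^ 2 - (m * v) ^ 2)) by (unfold quartic_defect; field).
lra.
Qed.

(** With [m = t^2] and [dx = t x'], the conclusion says [t E' > 0] for [E = x - t^2 level x] at a
    zero of [E], so [E] cannot reach zero from above. *)
Lemma level_first_contact (x m dx : R) :
  0 < x <= 21 / 10 -> 0 < m -> m * level x = x ->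
  x ^ 2 - x + quartic x m <= dx ->
  0 < dx * (1 + m * (581 / 200 - 69 / 200 * x ^ 2)) - 2 * m * level x.
Proof.
intros Hx Hm Hc Hdx.
assert (HG := level_flow_pos x ltac:(lra)).
assert (Hl := level_pos x ltac:(lra)).
assert (Hn : 0 < 581 / 200 - 69 / 200 * x ^ 2) by nra.
assert (Hk : 0 < 1 + m * (581 / 200 - 69 / 200 * x ^ 2)) by nra.
apply Rlt_le_trans with
  ((x ^ 2 - x + quartic x m) * (1 + m * (581 / 200 - 69 / 200 * x ^ 2)) - 2 * m * level x);
  [|apply Rplus_le_compat_r, Rmult_le_compat_r; lra].
apply Rmult_lt_reg_l with (level x ^ 2); [apply pow_lt; exact Hl|]. rewrite Rmult_0_r.
assert (Hm' : m = x / level x) by (rewrite <- Hc at 1; field; lra).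
replace (level x ^ 2 * ((x ^ 2 - x + quartic x m)
    * (1 + m * (581 / 200 - 69 / 200 * x ^ 2)) - 2 * m * level x))
  with (x ^ 2 * ((581 / 200 - 69 / 200 * x ^ 2)
     * ((2 - 4 / 5 * x + x ^ 2 / 50 + 9 / 100 * x ^ 3) * level x - 2 / 5 * x)
   - (level x ^ 2 * (4 / 5 - x / 50 - 9 / 100 * x ^ 2) + 2 / 5 * level x))).
- apply Rmult_lt_0_compat; [apply pow_lt; lra|exact HG].
- rewrite Hm'. unfold quartic. field. lra.
Qed.

Lemma reduced_bound_small (Q P : R -> R) (t : R) :
  profile Q P -> 0 < t <= 1 / 5 -> 3 * reduced Q t ^ 2 <= 2.
Proof.
intros HQ Ht. apply Rnot_lt_le. intros Hu.
rewrite reduced_sqr in Hu.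
assert (Hm : 0 < t ^ 2 <= 1 / 25) by nra.
assert (Hq0 := profile_pos Q P t HQ ltac:(lra)).
(* [u^2 > 2/3] and [t^2 <= 1/25] give [Q^2 >= 50/3], which persists at earlier times. *)
assert (HQt : 50 / 3 <= Q t ^ 2) by (unfold excess in Hu; nra).
assert (HQs : forall s, 0 < s <= t -> 47 / 3 * s ^ 2 <= excess Q s).
{ intros s Hs. assert (Hqs := profile_decreasing Q P s t HQ ltac:(lra)).
  assert (Q t ^ 2 <= Q s ^ 2) by (apply pow_incr; lra).
  assert (0 <= s ^ 2) by apply pow2_ge_0. unfold excess. nra. }
assert (Hxi : forall s, 0 < s <= t ->
   excess Q s / 3 + excess Q s ^ 2 / 15 + 2 / 45 * excess Q s * s ^ 2 <= slope Q P s).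
{ intros s Hs. apply slope_lower_bound; [exact HQ|lra|].
  intros z Hz. assert (HQz := HQs z ltac:(lra)). assert (0 <= z ^ 2) by apply pow2_ge_0. lra. }
(* While [E >= 0] the defect is nonnegative and the quartic barrier holds; the barrier in turn
   prevents [E] from vanishing. *)
set (E := fun s => slope Q P s - s ^ 2 * level (slope Q P s)).
assert (Hdef1 : forall s, 0 < s <= t -> 0 <= quartic_defect (slope Q P s) (s ^ 2)).
{ intros s Hs. assert (Hx0 := slope_pos Q P s HQ ltac:(lra)).
  assert (Hx1 := slope_lt Q P s HQ ltac:(lra)).
  assert (H1 := HQs s Hs). assert (H2 := Hxi s Hs).
  assert (Hs2 : 0 <= s ^ 2) by apply pow2_ge_0.
  (* [x >= N / 3 >= 47/9 s^2], and [26/5 < 47/9]. *)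
  apply quartic_defect_nonneg with (26 / 5); try lra.
  - assert (0 <= excess Q s ^ 2) by apply pow2_ge_0.
    assert (0 <= excess Q s * s ^ 2) by nra. lra.
  - apply initial_defect_nonneg. lra. }
assert (Hdef2 : forall s, t <= s <= 11 / 10 -> 0 <= E s -> 0 <= quartic_defect (slope Q P s) (s ^ 2)).
{ intros s Hs HE. assert (Hx0 := slope_pos Q P s HQ ltac:(lra)).
  assert (Hx1 := slope_lt Q P s HQ ltac:(lra)).
  apply quartic_defect_nonneg with (level (slope Q P s)); try lra.
  - apply pow2_ge_0.
  - apply level_pos. lra.
  - unfold E in HE. lra.
  - apply level_defect_nonneg. lra. }
assert (HE0 : 0 < E t).
{ assert (Hx := Hxi t ltac:(lra)). assert (Hx1 := slope_lt Q P t HQ ltac:(lra)).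
  set (N := excess Q t) in *. set (m := t ^ 2) in *.
  assert (HN : 2 / 3 - m < N) by lra.
  assert (HN2 : (2 / 3 - m) ^ 2 <= N ^ 2) by (apply pow_incr; lra).
  (* Just below the value of the bound [Hx] at [m = 1/25], [N = 2/3 - 1/25]. *)
  assert (Hx2 : 2361 / 10000 <= slope Q P t) by nra.
  assert (Hl := level_pos (slope Q P t) ltac:(lra)).
  assert (m * level (slope Q P t) <= 1 / 25 * level (slope Q P t))
    by (apply Rmult_le_compat_r; lra).
  unfold E. fold m. unfold level in *.
  assert (0 <= (slope Q P t - 2361 / 10000) * (6 / 5 - slope Q P t)) by nra.
  nra. }
assert (Hpos : forall b, t <= b <= 11 / 10 -> 0 < E b).
{ intros b Hb. apply Rnot_le_lt. intros HEb.
  destruct (continuous_first_zero E t b) as [s [Hs [Hs0 Hsp]]]; try lra.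
  { intros z Hz. assert (Hz0 : 0 < z) by lra. unfold E, level. slope_continuous HQ Hz0. }
  assert (Hs1 : 0 < s) by lra.
  assert (HN : quartic (slope Q P s) (s ^ 2) <= excess Q s).
  { apply excess_quartic_barrier; [exact HQ|exact Hs1|]. intros z Hz.
    destruct (Rle_lt_dec z t) as [Hzt|Hzt]; [apply Hdef1; lra|].
    apply Hdef2; [lra|]. destruct (Rlt_le_dec z s) as [Hzs|Hzs].
    - apply Rlt_le, Hsp. lra.
    - replace z with s by lra. lra. }
  set (x := slope Q P s).
  assert (Hx0 := slope_pos Q P s HQ Hs1). assert (Hx1 := slope_lt Q P s HQ Hs1).
  assert (Hl : ((x ^ 2 - x + excess Q s) * (1 + s ^ 2 * (581 / 200 - 69 / 200 * x ^ 2))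
     - 2 * s ^ 2 * level x) / s <= 0).
  { apply (derive_nonpos_of_left_pos E t s); auto; [lra|].
    unfold E, level, x. slope_derive HQ Hs1. }
  apply (proj1 (Rle_div_l _ _ _ Hs1)) in Hl. rewrite Rmult_0_l in Hl.
  assert (HG := level_first_contact x (s ^ 2) (x ^ 2 - x + excess Q s)
    ltac:(unfold x; lra) ltac:(nra) ltac:(unfold E in Hs0; fold x in Hs0; lra)
    ltac:(fold x in HN; lra)).
  lra. }
assert (HN : quartic (slope Q P (11 / 10)) ((11 / 10) ^ 2) <= excess Q (11 / 10)).
{ apply excess_quartic_barrier; [exact HQ|lra|]. intros z Hz.
  destruct (Rle_lt_dec z t) as [Hzt|Hzt]; [apply Hdef1; lra|].
  apply Hdef2; [lra|]. apply Rlt_le, Hpos. lra. }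
assert (HE := Hpos (11 / 10) ltac:(lra)).
assert (HK := slope_upper_bound Q P (11 / 10) HQ ltac:(lra)).
assert (Hx0 := slope_pos Q P (11 / 10) HQ ltac:(lra)).
assert (Hx1 := slope_lt Q P (11 / 10) HQ ltac:(lra)).
unfold E, level in HE. unfold quartic in HN.
set (x := slope Q P (11 / 10)) in *.
(* At [x = 2], [(11/10)^2 level x = 2.0328 > x]; thus [E > 0] requires a larger [x]. *)
assert (Hx2 : 2 < x).
{ apply Rnot_le_lt. intros Hle. assert (0 <= x * (2 - x) ^ 2) by (apply Rmult_le_pos; [lra|apply pow2_ge_0]). nra. }
(* At [x = 2] the quartic is [-0.568], while [HK] allows at most [-0.57]. Expanding around [2] shows
   that the gap only widens for larger [x]. *)
assert (0 <= (x - 2) ^ 3) by (apply pow_le; lra).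
assert (0 <= (x - 2) ^ 4) by (apply pow_le; lra).
assert (0 <= (x - 2) ^ 2) by apply pow2_ge_0.
nra.
Qed.

Theorem lemma4p2 (Q : R -> R) (HQ : ground_state_profile Q) (t : R) :
  ((0 < t /\ t <= 1 / 5) \/ 3 / 2 <= t) ->
  3 * (Q t) ^ 2 <= 2 / t ^ 2.
Proof.
destruct HQ as (P & Q2 & HP & HQ2 & Heq & Hzero & Hpos & Hlim).
assert (HQ : profile Q P).
{ split; [exact HP|split; [|auto]]. intros s Hs. specialize (Heq s Hs).
  replace (Q s - Q s ^ 3 - 2 / s * P s) with (Q2 s) by lra. now apply HQ2. }
intros Ht.
assert (Ht0 : 0 < t) by lra.
assert (Hu : 3 * reduced Q t ^ 2 <= 2).
{ destruct Ht as [Ht|Ht]; [now apply (reduced_bound_small Q P)|now apply (reduced_bound_large Q P)]. }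
assert (Ht2 : 0 < t ^ 2) by (apply pow_lt; exact Ht0).
apply (proj1 (Rle_div_r _ _ _ Ht2)).
unfold reduced in Hu. rewrite Rpow_mult_distr in Hu. lra.
Qed.
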